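(* Let $\mathcal{H}$ be a complex Hilbert space with $\dim \mathcal{H} \geq 3$ and let $\phi: B_s(\mathcal{H}) \to B_s(\mathcal{H})$ be a surjective map (not assumed injective, linear or continuous) such that for all $A,B,C\in B_s(\mathcal{H})$, $$A-B \leftrightarrow_q C \iff \phi(A)-\phi(B) \leftrightarrow_q \phi(C).$$ Then there exist a nonzero real scalar $c$, a function $f: B_s(\mathcal{H})\to\mathbb{R}$, and an operator $U$ on $\mathcal{H}$ which is either unitary or antiunitary, such that $$\phi(A) = c\, U A U^{*} + f(A) I \quad \text{for all } A\in B_s(\mathcal{H}).$$ Moreover, the function $f$ necessarily vanishes at every $A\in B_s(\mathcal{H})$ for which there exists a nonzero operator $B\in B_s(\mathcal{H})$, not commuting with $A$, such that $AB+BA=0$.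
   Context: $B_s(\mathcal{H})$ denotes the set of all bounded self-adjoint linear operators on $\mathcal{H}$. The space $\mathcal{H}$ is not assumed separable. For $X,Y\in B_s(\mathcal{H})$, $X\leftrightarrow_q Y$ (quasi-commutativity) means that $XY=YX$ or $XY=-YX$. An antiunitary operator is a conjugate-linear bijection $U$ with $\langle Ux,Uy\rangle=\overline{\langle x,y\rangle}$ for all $x,y$; in both the unitary and the antiunitary case $U^{*}=U^{-1}$. *)

(* Defs.v *)
From HB Require Import structures.
From mathcomp Require Import all_boot all_order all_algebra.
From mathcomp Require Import complex.
From mathcomp Require Import all_classical all_reals all_analysis.

Set Implicit Arguments.
Unset Strict Implicit.
Unset Printing Implicit Defensive.

Import Order.TTheory GRing.Theory Num.Theory.
Import numFieldNormedType.Exports.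

Local Open Scope ring_scope.

(* The inner product is linear in the first variable. *)
HB.mixin Record NormedModule_isHilbert (R : realType) (H : Type)
    of CompleteNormedModule R[i] H := {
  inner : {dot H for (Num.conj : R[i] -> R[i])};
  sqr_norm_inner : forall x : H, `|x| ^+ 2 = inner x x
}.

#[short(type="hilbertType")]
HB.structure Definition Hilbert (R : realType) :=
  {H of NormedModule_isHilbert R H & CompleteNormedModule R[i] H}.

Section HilbertSpace.
Variables (R : realType) (H : hilbertType R).

Local Notation "''[' x , y ]" := (inner x y) : ring_scope.

Definition dim_ge (n : nat) : Prop :=
  exists v : 'I_n -> H, forall a : 'I_n -> R[i],
    \sum_(i < n) a i *: v i = 0 -> forall i, a i = 0.

(* For a linear map, boundedness near 0 is boundedness as an operator
   (linear_boundedP). *)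
Record bounded_self_adjoint := BoundedSelfAdjoint {
  bsa_op :> {linear H -> H};
  bsa_bounded : bounded_near bsa_op (nbhs (0 : H));
  bsa_sym : forall x y : H, '[bsa_op x, y] = '[x, bsa_op y]
}.

Definition commute_op (X Y : H -> H) : Prop := X \o Y = Y \o X.

Definition anticommute_op (X Y : H -> H) : Prop := X \o Y = \- (Y \o X).

Definition quasi_commute (X Y : H -> H) : Prop :=
  commute_op X Y \/ anticommute_op X Y.

Definition conj_linear (U : H -> H) : Prop :=
  forall (a : R[i]) (x y : H), U (a *: x + y) = a^* *: U x + U y.

Definition unitary (U : H -> H) : Prop :=
  [/\ linear U, bijective U & forall x y : H, '[U x, U y] = '[x, y]].

Definition antiunitary (U : H -> H) : Prop :=
  [/\ conj_linear U, bijective U & forall x y : H, '[U x, U y] = '[x, y]^*].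

(* Ustar is the adjoint of U, resp. the adjoint of U in the sense of
   conjugate-linear operators; such a Ustar is unique. *)
Definition adjoint_of (U Ustar : H -> H) : Prop :=
  forall x y : H, '[U x, y] = '[x, Ustar y].

Definition conj_adjoint_of (U Ustar : H -> H) : Prop :=
  forall x y : H, '[U x, y] = '[x, Ustar y]^*.

Definition standard_form
    (phi : bounded_self_adjoint -> bounded_self_adjoint)
    (c : R) (f : bounded_self_adjoint -> R) (U Ustar : H -> H) : Prop :=
  [/\ c != 0,
      (unitary U /\ adjoint_of U Ustar) \/
      (antiunitary U /\ conj_adjoint_of U Ustar) &
      forall (A : bounded_self_adjoint) (x : H),
        phi A x = c%:C%C *: U (A (Ustar x)) + (f A)%:C%C *: x].

End HilbertSpace.

(* Main.v *)
Require Import Defs.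
From HB Require Import structures.
From mathcomp Require Import all_boot all_order all_algebra.
From mathcomp Require Import complex.
From mathcomp Require Import all_classical all_reals all_analysis.
From mathcomp Require Import ring lra.

(** Letting A run through A + R I turns quasi-commutation into commutation, so
    phi preserves, in both directions, "A - B commutes with C"; on operators
    modulo scalars it therefore maps cosets of a centralizer or of a bicommutant
    to cosets of the same kind.  An operator with minimal bicommutant that has a
    non-commuting anticommuting partner has scalar square, which singles out the
    multiples of reflections 2Q - I without any spectral theory, and among those
    the ones with a one-dimensional eigenspace are recognized by bicommutants.
    Hence phi induces an orthogonality preserving bijection T of the rays and
    sends each line A + R P_x into a line phi(A) + R P_(Tx) + R I.
    Parallelograms in two such directions make phi additive on the span of the
    rank-one projections; the identity P_u + P_v = 2a^2 P_x + 2b^2 P_y for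
    u, v = ax +- by makes it homogeneous, with one factor c for all rays.  The
    parallelogram law for x + u, x - u then shows that T preserves transition
    probabilities, and Wigner's theorem gives U.  A general A is compared at
    each x with a rank-two B such that x is an eigenvector of A - B: it follows
    that every vector is an eigenvector of phi(A) - c U A U^*. *)

Set Implicit Arguments.
Unset Strict Implicit.
Unset Printing Implicit Defensive.

Import Order.TTheory GRing.Theory Num.Theory.
Import numFieldNormedType.Exports.
Local Open Scope ring_scope.

(* Sealing R[i] behind a constant keeps the inference of its algebraic
   structures on a single path. *)
Definition Cx (R : realType) : numClosedFieldType := R[i].

Definition rc (R : realType) (r : R) : Cx R := r%:C%C.

Definition dot (R : realType) (H : hilbertType R) (x y : H) : Cx R := inner x y.
Arguments dot : simpl never.

(** * Real scalars inside the complex ones *)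

Section Scalars.
Variables (R : realType).
Implicit Types (a b c : Cx R) (r s : R).

Fact rc_is_additive : zmod_morphism (@rc R).
Proof. exact: rmorphB. Qed.
Fact rc_is_multiplicative : GRing.monoid_morphism (@rc R).
Proof. by split; [exact: rmorph1 | exact: rmorphM]. Qed.
HB.instance Definition _ := GRing.isZmodMorphism.Build R (Cx R) (@rc R)
  rc_is_additive.
HB.instance Definition _ := GRing.isMonoidMorphism.Build R (Cx R) (@rc R)
  rc_is_multiplicative.

Lemma rcD r s : rc (r + s) = rc r + rc s. Proof. exact: rmorphD. Qed.
Lemma rcN r : rc (- r) = - rc r. Proof. exact: rmorphN. Qed.
Lemma rcM r s : rc (r * s) = rc r * rc s. Proof. exact: rmorphM. Qed.
Lemma rcV r : rc r^-1 = (rc r)^-1. Proof. exact: fmorphV. Qed.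
Lemma rc0 : rc 0 = 0 :> Cx R. Proof. by []. Qed.
Lemma rc1 : rc 1 = 1 :> Cx R. Proof. by []. Qed.
Definition rcE := (rcD, rcN, rcM, rcV, rc0, rc1).

Lemma ler_rc r s : (rc r <= rc s) = (r <= s).
Proof. exact: lecR. Qed.

Lemma ltr_rc r s : (rc r < rc s) = (r < s).
Proof. exact: ltcR. Qed.

Lemma rc_inj : injective (@rc R).
Proof. by move=> r s [->]. Qed.

Lemma rc_eq0 r : (rc r == 0) = (r == 0).
Proof. by rewrite fmorph_eq0. Qed.

Lemma conj_rc r : (rc r)^* = rc r.
Proof. by apply/eqP; rewrite eq_complex /= oppr0 !eqxx. Qed.

Lemma conj_eq_rc c : c^* = c -> exists r, c = rc r.
Proof.
case: c => a b /eqP; rewrite eq_complex /= => /andP[_ /eqP h].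
by exists a; congr Complex; lra.
Qed.

Lemma conjD a b : (a + b)^* = a^* + b^*. Proof. exact: rmorphD. Qed.
Lemma conjN a : (- a)^* = - a^*. Proof. exact: rmorphN. Qed.
Lemma conjM a b : (a * b)^* = a^* * b^*. Proof. exact: rmorphM. Qed.
Lemma conjV a : (a^-1)^* = a^*^-1. Proof. exact: fmorphV. Qed.
Definition conjE := (conjD, conjN, conjM, conjV, @conjCK (Cx R)).
End Scalars.

(** * The inner product and the Cauchy-Schwarz inequality *)

Section InnerProduct.
Variables (R : realType) (H : hilbertType R).
Local Notation "''[' x , y ]" := (dot x y) : ring_scope.
Implicit Types (x y z : H) (a b : Cx R) (r : R).

Lemma cscalerA a b x : a *: (b *: x) = (a * b) *: x.
Proof. exact: scalerA. Qed.
Lemma cscalerDl a b x : (a + b) *: x = a *: x + b *: x.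
Proof. exact: scalerDl. Qed.
Lemma cscalerBl a b x : (a - b) *: x = a *: x - b *: x.
Proof. exact: scalerBl. Qed.
Lemma cscaleNr a x : (- a) *: x = - (a *: x).
Proof. exact: scaleNr. Qed.
Lemma cscale1r x : (1 : Cx R) *: x = x.
Proof. exact: scale1r. Qed.
Lemma cscale0r x : (0 : Cx R) *: x = 0.
Proof. exact: scale0r. Qed.
Lemma cscaler_eq0 a x : (a *: x == 0) = (a == 0) || (x == 0).
Proof. exact: scaler_eq0. Qed.

Lemma dotDl x y z : '[x + y, z] = '[x, z] + '[y, z].
Proof. exact: linearDl. Qed.
Lemma dotDr x y z : '[z, x + y] = '[z, x] + '[z, y].
Proof. exact: linearDr. Qed.
Lemma dotNl x z : '[- x, z] = - '[x, z].
Proof. exact: linearNl. Qed.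
Lemma dotNr x z : '[z, - x] = - '[z, x].
Proof. exact: linearNr. Qed.
Lemma dotZl a x z : '[a *: x, z] = a * '[x, z].
Proof. exact: linearZl_LR. Qed.
Lemma dotZr a x z : '[z, a *: x] = a^* * '[z, x].
Proof. exact: linearZr_LR. Qed.
Lemma dot0l x : '[0, x] = 0. Proof. exact: linear0l. Qed.
Lemma dot0r x : '[x, 0] = 0. Proof. exact: linear0r. Qed.

Lemma dotC x y : '[x, y] = '[y, x]^*.
Proof. by rewrite /dot (hermC inner x y) expr0 mul1r. Qed.

Definition dotE := (dotDl, dotDr, dotNl, dotNr, dotZl, dotZr,
  dot0l, dot0r, conj_rc, conjE).

Lemma dot_eq0 x : ('[x, x] == 0) = (x == 0).
Proof. exact: (dnorm_eq0 inner). Qed.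

Lemma dot_inj x y : (forall z, '[x, z] = '[y, z]) -> x = y.
Proof.
move=> h; apply/eqP; rewrite -subr_eq0 -dot_eq0 dotDl dotNl h.
by rewrite subrr.
Qed.

Lemma dot_conj x : '[x, x]^* = '[x, x].
Proof. by rewrite -dotC. Qed.

Lemma dot_gt0 x : (0 < '[x, x]) = (x != 0).
Proof. exact: (dnorm_gt0 inner). Qed.

Lemma dot_ge0 x : 0 <= '[x, x].
Proof. exact: (dnorm_ge0 inner). Qed.

Lemma dot_real x : x != 0 -> exists2 r : R, 0 < r & '[x, x] = rc r.
Proof.
rewrite -dot_gt0; have [r ->] := conj_eq_rc (dot_conj x).
by rewrite -[0]/(rc 0) ltr_rc => r0; exists r.
Qed.

Lemma sqr_norm_dot x : `|x| ^+ 2 = '[x, x].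
Proof. exact: sqr_norm_inner. Qed.

(** The squared norm of the difference of the two sides expands to an expression that the hypothesis
    makes zero. Used to recover a ray from a transition probability. *)
Lemma cauchy_schwarz_eq x y : y != 0 ->
  '[x, y] * '[y, x] = '[x, x] * '[y, y] -> x = ('[x, y] / '[y, y]) *: y.
Proof.
move=> y0 h; have yy : '[y, y] != 0 by rewrite dot_eq0.
apply/eqP; rewrite -subr_eq0 -dot_eq0; apply/eqP.
rewrite !dotE dot_conj -(dotC y x).
have -> : '[x, x] = '[x, y] * '[y, x] / '[y, y] by rewrite h mulfK.
by field.
Qed.

Lemma cauchy_schwarz x y : `|'[x, y]| <= `|x| * `|y| :> Cx R.
Proof.
have [->|y0] := eqVneq y 0; first by rewrite dot0r !normr0 mulr0.
have yy : '[y, y] != 0 by rewrite dot_eq0.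
have := dot_ge0 (x - ('[x, y] / '[y, y]) *: y).
have -> : '[x - ('[x, y] / '[y, y]) *: y, x - ('[x, y] / '[y, y]) *: y] =
    ('[x, x] * '[y, y] - '[x, y] * '[x, y]^*) / '[y, y].
  by rewrite !dotE dot_conj -(dotC y x); field.
rewrite pmulr_lge0 ?invr_gt0 ?dot_gt0// subr_ge0 -normCK => h.
rewrite -(@ler_pXn2r _ 2)// ?nnegrE ?mulr_ge0//.
by rewrite exprMn !sqr_norm_dot.
Qed.
End InnerProduct.

(** * The real vector space of bounded self-adjoint operators *)

Section Operators.
Variables (R : realType) (H : hilbertType R).
Local Notation S := (bounded_self_adjoint H).
Local Notation "''[' x , y ]" := (dot x y) : ring_scope.

Lemma bounded_near0 (f : {linear H -> H}) (M : Cx R) : 0 <= M ->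
  (forall x, `|f x| <= M * `|x|) -> bounded_near f (nbhs (0 : H)).
Proof.
move=> M0 h; apply/linear_boundedP; near=> r => x.
apply: (le_trans (h x)); rewrite ler_wpM2r//.
by near: r; apply: nbhs_pinfty_ge; rewrite ger0_real.
Unshelve. all: by end_near. Qed.

Lemma bsa_bound (A : S) : exists2 M : Cx R, 0 <= M &
  forall x, `|A x| <= M * `|x|.
Proof.
have /linear_boundedP /pinfty_ex_gt0[M /ltW M0 h] := bsa_bounded A.
by exists M.
Qed.

Lemma bsa_dot (A : S) x y : '[A x, y] = '[x, A y].
Proof. exact: bsa_sym. Qed.

Lemma bsaP (A B : S) : (forall x, A x = B x) -> A = B.
Proof.
case: A B => [A bA sA] [B bB sB] /= h.
have e : A = B.
  case: A B h {bA sA bB sB} => [A [[A1] [A2]]] [B [[B1] [B2]]] /= /funext e.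
  subst B; congr GRing.Linear.Pack; congr GRing.Linear.Class;
    congr (_ _); exact: Prop_irrelevance.
subst B; congr BoundedSelfAdjoint; exact: Prop_irrelevance.
Qed.

(** The result is a sigma type rather than an existence statement, so that operations on
    [bounded_self_adjoint] can be defined as first projections. *)
Lemma bsa_exists (f : H -> H) (M : Cx R) : linear f -> 0 <= M ->
  (forall x, `|f x| <= M * `|x|) -> (forall x y, '[f x, y] = '[x, f y]) ->
  {A : S | A = f :> (H -> H)}.
Proof.
move=> lf M0 bf sf.
pose fm := GRing.isLinear.Build _ _ _ _ f lf.
pose g : {linear H -> H} := HB.pack f fm.
by exists (@BoundedSelfAdjoint R H g (bounded_near0 (f := g) M0 bf) sf).
Qed.

Lemma bsa_zero_ex : {A : S | A = (fun=> 0) :> (H -> H)}.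
Proof.
apply: (@bsa_exists _ 0) => // [a x y|x|x y].
- by rewrite scaler0 addr0.
- by rewrite normr0 mul0r.
- by rewrite !dotE.
Qed.

Lemma bsa_add_ex (A B : S) : {C : S | C = (fun x => A x + B x) :> (H -> H)}.
Proof.
have /cid2[M M0 hM] := bsa_bound A; have /cid2[N N0 hN] := bsa_bound B.
apply: (@bsa_exists _ (M + N)) => [a x y||x|x y].
- by rewrite !linearP/= scalerDr addrACA.
- exact: addr_ge0.
- by rewrite mulrDl (le_trans (ler_normD _ _))// lerD.
- by rewrite !dotE !bsa_dot.
Qed.

Lemma bsa_scale_ex (r : R) (A : S) :
  {C : S | C = (fun x => rc r *: A x) :> (H -> H)}.
Proof.
have /cid2[M M0 hM] := bsa_bound A.
apply: (@bsa_exists _ (`|rc r| * M)) => [a x y||x|x y].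
- by rewrite linearP/= scalerDr !scalerA mulrC.
- exact: mulr_ge0.
- by rewrite normrZ -mulrA ler_wpM2l.
- by rewrite !dotE !bsa_dot.
Qed.

Lemma bsa_one_ex : {C : S | C = id :> (H -> H)}.
Proof. by apply: (@bsa_exists _ 1) => // x; rewrite mul1r. Qed.

Lemma bsa_sqr_ex (A : S) : {C : S | C = (fun x => A (A x)) :> (H -> H)}.
Proof.
have /cid2[M M0 hM] := bsa_bound A.
apply: (@bsa_exists _ (M * M)) => [a x y||x|x y].
- by rewrite !linearP.
- exact: mulr_ge0.
- by rewrite -mulrA (le_trans (hM _))// ler_wpM2l.
- by rewrite !bsa_dot.
Qed.

Lemma bsa_proj_ex (z : H) : {C : S | C = (fun x => '[x, z] *: z) :> (H -> H)}.
Proof.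
apply: (@bsa_exists _ (`|z| * `|z|)) => [a x y||x|x y].
- by rewrite !dotE scalerDl scalerA.
- exact: mulr_ge0.
- by rewrite normrZ mulrAC ler_wpM2r// mulrC cauchy_schwarz.
- by rewrite !dotE -dotC mulrC.
Qed.

HB.instance Definition _ := gen_eqMixin S.
HB.instance Definition _ := gen_choiceMixin S.

Definition bsa_zero : S := projT1 bsa_zero_ex.
Definition bsa_add (A B : S) : S := projT1 (bsa_add_ex A B).
Definition bsa_scale (r : R) (A : S) : S := projT1 (bsa_scale_ex r A).
Definition bsa_opp (A : S) : S := bsa_scale (-1) A.
Definition bsa_one : S := projT1 bsa_one_ex.
Definition bsa_sqr (A : S) : S := projT1 (bsa_sqr_ex A).
(** Not normalized: this is the squared norm of [z] times the orthogonal projection onto the line of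
    [z], hence 0 for [z = 0]. *)
Definition bsa_proj (z : H) : S := projT1 (bsa_proj_ex z).

Let zeroE x : bsa_zero x = 0.
Proof. exact: (congr1 (@^~ x) (projT2 bsa_zero_ex)). Qed.
Let addE A B x : bsa_add A B x = A x + B x.
Proof. exact: (congr1 (@^~ x) (projT2 (bsa_add_ex A B))). Qed.
Let scaleE r A x : bsa_scale r A x = rc r *: A x.
Proof. exact: (congr1 (@^~ x) (projT2 (bsa_scale_ex r A))). Qed.
Lemma bsa_oneE x : bsa_one x = x.
Proof. exact: (congr1 (@^~ x) (projT2 bsa_one_ex)). Qed.
Lemma bsa_sqrE A x : bsa_sqr A x = A (A x).
Proof. exact: (congr1 (@^~ x) (projT2 (bsa_sqr_ex A))). Qed.
Lemma bsa_projE z x : bsa_proj z x = '[x, z] *: z.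
Proof. exact: (congr1 (@^~ x) (projT2 (bsa_proj_ex z))). Qed.

Let addA : associative bsa_add.
Proof. by move=> A B C; apply: bsaP => x; rewrite !addE addrA. Qed.
Let addC : commutative bsa_add.
Proof. by move=> A B; apply: bsaP => x; rewrite !addE addrC. Qed.
Let add0 : left_id bsa_zero bsa_add.
Proof. by move=> A; apply: bsaP => x; rewrite addE zeroE add0r. Qed.
Let addN : left_inverse bsa_zero bsa_opp bsa_add.
Proof.
move=> A; apply: bsaP => x; rewrite addE zeroE scaleE.
by rewrite rmorphN1 scaleN1r addNr.
Qed.
HB.instance Definition _ := GRing.isZmodule.Build S addA addC add0 addN.

Let scaleA a b A : bsa_scale a (bsa_scale b A) = bsa_scale (a * b) A.
Proof. by apply: bsaP => x; rewrite !scaleE scalerA rmorphM. Qed.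
Let scale1 : left_id 1 bsa_scale.
Proof. by move=> A; apply: bsaP => x; rewrite scaleE rmorph1 scale1r. Qed.
Let scaleDr : right_distributive bsa_scale +%R.
Proof. by move=> a A B; apply: bsaP => x; rewrite !(addE, scaleE) scalerDr. Qed.
Let scaleDl A : {morph bsa_scale^~ A : a b / a + b}.
Proof.
by move=> a b; apply: bsaP => x; rewrite !(addE, scaleE) rmorphD scalerDl.
Qed.
HB.instance Definition _ := GRing.Zmodule_isLmodule.Build R S
  scaleA scale1 scaleDr scaleDl.

Lemma bsa0E x : (0 : S) x = 0. Proof. exact: zeroE. Qed.
Lemma bsaDE (A B : S) x : (A + B) x = A x + B x. Proof. exact: addE. Qed.
Lemma bsaZE r (A : S) x : (r *: A) x = rc r *: A x. Proof. exact: scaleE. Qed.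
Lemma bsaNE (A : S) x : (- A) x = - A x.
Proof. by rewrite -scaleN1r bsaZE rmorphN1 scaleN1r. Qed.

Definition bsaE := (bsa0E, bsaDE, bsaNE, bsaZE, bsa_oneE, bsa_sqrE, bsa_projE).

Lemma bsa_subE (A B : S) : (A \- B : H -> H) = (A - B : S).
Proof. by apply/funext => x; rewrite !bsaE. Qed.

End Operators.

(** * Eigenvectors and commutation with rank-one projections *)

Section Eigenvectors.
Variables (R : realType) (H : hilbertType R).
Local Notation S := (bounded_self_adjoint H).
Local Notation "''[' x , y ]" := (dot x y) : ring_scope.
Local Notation I := (bsa_one H).
Local Notation P := (@bsa_proj R H).
Implicit Types (A B C D E G : S) (x y z u v w : H) (a b : Cx R) (r s t : R).

Lemma opD A x y : A (x + y) = A x + A y. Proof. exact: linearD. Qed.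
Lemma opN A x : A (- x) = - A x. Proof. exact: linearN. Qed.
Lemma opZ A a x : A (a *: x) = a *: A x. Proof. exact: linearZ. Qed.
Lemma op0 A : A 0 = 0. Proof. exact: linear0. Qed.
Definition opE := (opD, opN, opZ, op0).

Lemma bsa_ext A B : (forall x y, '[A x, y] = '[B x, y]) -> A = B.
Proof. by move=> h; apply: bsaP => x; apply: dot_inj => y. Qed.

Lemma cscaler_inj x a b : x != 0 -> a *: x = b *: x -> a = b.
Proof.
move=> x0 /eqP; rewrite -subr_eq0 -cscalerBl cscaler_eq0 (negPf x0) orbF.
by rewrite subr_eq0 => /eqP.
Qed.

Definition comm A B : Prop := forall x, A (B x) = B (A x).

(** The zero vector counts as an eigenvector, so that [comm_proj] holds for every [x]. *)
Definition eig A x : Prop := exists a, A x = a *: x.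

Definition parallel x y : Prop := exists a, y = a *: x.

Definition is_scalar A : Prop := exists r, A = r *: I.

Lemma commC A B : comm A B -> comm B A.
Proof. by move=> h x; rewrite h. Qed.

Lemma commI A r : comm A (r *: I).
Proof. by move=> x; rewrite !(bsaE, opE). Qed.

Lemma commD A B C : comm A C -> comm B C -> comm (A + B) C.
Proof. by move=> hA hB x; rewrite !bsaE hA hB opE. Qed.

Lemma commZ A B r : comm A B -> comm (r *: A) B.
Proof. by move=> h x; rewrite !bsaE h opE. Qed.

Lemma commN A B : comm A B -> comm (- A) B.
Proof. by rewrite -scaleN1r; exact: commZ. Qed.

Lemma commB A B C : comm A C -> comm B C -> comm (A - B) C.
Proof. by move=> hA hB; apply: commD => //; apply: commN. Qed.

Lemma eigenvalue_real A x a : x != 0 -> A x = a *: x -> exists r, a = rc r.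
Proof.
move=> x0 Ax; apply: conj_eq_rc.
have xx : '[x, x] != 0 by rewrite dot_eq0.
by apply: (mulIf xx); rewrite -dotZr -dotZl -Ax bsa_dot.
Qed.

Lemma eig_real A x : eig A x -> exists r, A x = rc r *: x.
Proof.
have [->|x0] := eqVneq x 0; first by exists 0; rewrite op0 scaler0.
by case=> a /[dup] /(eigenvalue_real x0)[r ->] ?; exists r.
Qed.

Lemma eigZ A x a : eig A x -> eig A (a *: x).
Proof. by case=> b h; exists b; rewrite opE h !cscalerA mulrC. Qed.

(** The dictionary between commutation and eigenvectors. Evaluating at [x] gives the eigenvalue;
    conversely self-adjointness moves [A] across the inner product, and the eigenvalue is real. *)
Lemma comm_proj A x : comm A (P x) <-> eig A x.
Proof.
split=> [h|[a Ax] v].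
- have [->|x0] := eqVneq x 0; first by exists 0; rewrite op0 scaler0.
  have xx : '[x, x] != 0 by rewrite dot_eq0.
  exists ('[A x, x] / '[x, x]); have := h x; rewrite !bsaE opE => e.
  by rewrite mulrC -cscalerA -e cscalerA mulVf// cscale1r.
- rewrite !bsaE opE bsa_dot Ax dotZr.
  have [->|x0] := eqVneq x 0; first by rewrite !scaler0.
  have [r ->] := eigenvalue_real x0 Ax.
  by rewrite !cscalerA conj_rc mulrC.
Qed.

(** Two independent eigenvectors whose sum is again an eigenvector have the same eigenvalue. [K]
    will be an eigenspace, or its intersection with an orthogonal complement. *)
Lemma eig_common A (K : H -> Prop) :
  (forall x y, K x -> K y -> K (x + y)) -> (forall x, K x -> eig A x) ->
  exists r, forall x, K x -> A x = rc r *: x.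
Proof.
move=> KD Keig.
have [[x [Kx x0]]|no] := pselect (exists x, K x /\ x != 0); last first.
  exists 0 => x Kx; have [->|x0] := eqVneq x 0; first by rewrite op0 scaler0.
  by case: no; exists x.
have [r Ax] := eig_real (Keig x Kx); exists r => y Ky.
have [s Ay] := eig_real (Keig y Ky).
have [t] := eig_real (Keig _ (KD _ _ Kx Ky)); rewrite opE Ax Ay => e.
have e' : (rc r - rc t) *: x = (rc t - rc s) *: y.
  by apply/eqP; rewrite !cscalerBl subr_eq addrAC eq_sym subr_eq eq_sym e
    scalerDr addrC.
have [rt|rt] := eqVneq r t.
  move/eqP: e'; rewrite rt subrr cscale0r eq_sym cscaler_eq0 => /orP[|/eqP->].
    by rewrite subr_eq0 => /eqP <-.
  by rewrite !scaler0.
have rt0 : rc r - rc t != 0 by rewrite -rmorphB rc_eq0 subr_eq0.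
have xy : x = ((rc t - rc s) / (rc r - rc t)) *: y.
  by rewrite mulrC -cscalerA -e' cscalerA mulVf// cscale1r.
have : rc r *: x = rc s *: x.
  by rewrite -Ax {1 2}xy opZ Ay !cscalerA mulrC.
by move/(cscaler_inj x0) ->.
Qed.

Lemma scalar_eig A : (forall x, eig A x) -> is_scalar A.
Proof.
move=> h; have [r hr] := @eig_common A (fun=> True) (fun _ _ _ _ => Logic.I)
  (fun x _ => h x).
by exists r; apply: bsaP => x; rewrite !bsaE hr.
Qed.

(** A Gram-Schmidt step; [w] serves later as a vector orthogonal to [x] but not to [y]. *)
Lemma perp_part x y : x != 0 -> ~ parallel x y ->
  exists a w, [/\ y = a *: x + w, '[w, x] = 0, '[w, y] != 0 & w != 0].
Proof.
move=> x0 npar; have xx : '[x, x] != 0 by rewrite dot_eq0.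
pose a := '[y, x] / '[x, x]; pose w := y - a *: x.
have yE : y = a *: x + w by rewrite /w addrC subrK.
have wx : '[w, x] = 0 by rewrite /w /a !dotE; field.
have w0 : w != 0.
  apply/eqP => w0; apply: npar; exists a; by rewrite yE w0 addr0.
exists a, w; split=> //.
by rewrite {1}yE dotDr dotZr wx mulr0 add0r dot_eq0.
Qed.

Lemma eig_projP x y : y != 0 -> eig (P x) y -> '[x, y] = 0 \/ parallel y x.
Proof.
move=> y0 [a]; rewrite bsaE.
have [xy _|xy h] := eqVneq '[y, x] 0; first by left; rewrite dotC xy conjC0.
right; exists ('[y, x]^-1 * a); rewrite -cscalerA -h cscalerA.
by rewrite mulVf// cscale1r.
Qed.

Lemma eig_proj_perp x y : '[y, x] = 0 -> eig (P x) y.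
Proof. by move=> yx; exists 0; rewrite bsaE yx !cscale0r. Qed.

Lemma eig_proj_self x : eig (P x) x.
Proof. by exists '[x, x]; rewrite bsaE. Qed.

Lemma dot_eq0C x y : '[x, y] = 0 -> '[y, x] = 0.
Proof. by move=> h; rewrite dotC h conjC0. Qed.

End Eigenvectors.

(** * Reflections and rank-one projections in terms of commutation *)

Section Reflections.
Variables (R : realType) (H : hilbertType R).
Local Notation S := (bounded_self_adjoint H).
Local Notation "''[' x , y ]" := (dot x y) : ring_scope.
Local Notation I := (bsa_one H).
Local Notation P := (@bsa_proj R H).
Implicit Types (A B C D E G : S) (x y z u v w : H) (a b : Cx R) (r s t : R).

Definition bicommutant A D : Prop := forall G, comm G A -> comm G D.

(** [bicommutant A D] together with [bicommutant D A] means {A}'' = {D}'', so {A}'' is minimal among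
    the bicommutants of non-scalar operators. *)
Definition minimal_bicommutant A : Prop :=
  ~ is_scalar A /\
  forall D, bicommutant A D -> ~ is_scalar D -> bicommutant D A.

Definition anticomm A B : Prop := forall x, A (B x) = - B (A x).

Definition has_antipartner A : Prop := exists B, anticomm B A /\ ~ comm B A.

(** These are the operators [s (2Q - I)] with [Q] a projection other than 0 and [I]. The sign of [s]
    is free, so [reflN] exchanges the two eigenspaces. *)
Record reflection A s : Prop := Reflection {
  refl_neq0 : s != 0;
  refl_sqr : forall v, A (A v) = rc (s ^+ 2) *: v;
  refl_pos : exists2 x : H, x != 0 & A x = rc s *: x;
  refl_neg : exists2 x : H, x != 0 & A x = - (rc s *: x)
}.

Lemma reflN A s : reflection A s -> reflection A (- s).
Proof.
case=> s0 A2 [x x0 Ax] [y y0 Ay]; split; rewrite ?oppr_eq0 ?sqrrN//.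
- by exists y => //; rewrite Ay rcE cscaleNr.
- by exists x => //; rewrite rcE cscaleNr opprK.
Qed.

Lemma refl_orth A s x y : s != 0 -> A x = rc s *: x -> A y = - (rc s *: y) ->
  '[x, y] = 0.
Proof.
move=> s0 Ax Ay; have := bsa_dot A x y; rewrite Ax Ay !dotE => /eqP.
rewrite -subr_eq0 opprK -mulr2n mulrn_eq0 /= mulf_eq0 rc_eq0 (negPf s0).
by move=> /eqP.
Qed.

Lemma refl_part A s v : reflection A s -> exists x y,
  [/\ v = x + y, A x = rc s *: x & A y = - (rc s *: y)].
Proof.
move=> rA; have s0 : rc s != 0 by rewrite rc_eq0 (refl_neq0 rA).
exists (2^-1 *: (v + (rc s)^-1 *: A v)), (2^-1 *: (v - (rc s)^-1 *: A v)).
split; apply: dot_inj => z; rewrite ?opE ?(refl_sqr rA) !dotE ?expr2 ?rcE;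
  field => //.
Qed.

Lemma eigenspace_common A D a : (forall x, eig A x -> eig D x) ->
  exists r, forall x, A x = a *: x -> D x = rc r *: x.
Proof.
move=> AD; apply: eig_common => [x y hx hy|x hx].
  by rewrite opE hx hy scalerDr.
by apply: AD; exists a.
Qed.

(** By [comm_proj] every eigenvector of [A] is one of [D], so [D] acts as a scalar on each of the
    two eigenspaces of [A]; interpolating between these two values gives the combination. *)
Lemma refl_bic A s D : reflection A s -> bicommutant A D ->
  exists p q : R, D = p *: A + q *: I.
Proof.
move=> rA AD; have s0 := refl_neq0 rA.
have eD x : eig A x -> eig D x.
  by move=> h; apply/comm_proj/commC/AD/commC/comm_proj.
have [p hp] := eigenspace_common (rc s) eD.
have [q hq] := eigenspace_common (- rc s) eD.
exists ((p - q) / (s *+ 2)), ((p + q) / 2); apply: bsaP => v.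
have [x [y [-> Ax Ay]]] := refl_part v rA.
rewrite !(bsaE, opE) Ax Ay (hp _ Ax) (hq y); last by rewrite Ay cscaleNr.
apply: dot_inj => z; rewrite !dotE mulr2n !rcE.
by field; rewrite -mulr2n mulrn_eq0 fmorph_eq0 s0.
Qed.

Lemma refl_nonscalar A s : reflection A s -> ~ is_scalar A.
Proof.
case=> s0 _ [x x0 Ax] [y y0 Ay] [r Ar].
have : rc s = rc r by apply: (cscaler_inj x0); rewrite -Ax Ar !bsaE.
have : - rc s = rc r.
  by apply: (cscaler_inj y0); rewrite cscaleNr -Ay Ar !bsaE.
move=> <- /eqP; rewrite -subr_eq0 opprK -mulr2n mulrn_eq0 /= rc_eq0.
by rewrite (negPf s0).
Qed.

Lemma bic_comb A r s : bicommutant A (r *: A + s *: I).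
Proof.
by move=> G GA; apply/commC/commD; [apply/commZ/commC | apply/commC/commI].
Qed.

Lemma comb_bic A r s : r != 0 -> bicommutant (r *: A + s *: I) A.
Proof.
move=> r0 G GA; have -> : A = r^-1 *: (r *: A + s *: I) + (- (s / r)) *: I.
  rewrite scalerDr !scalerA mulVf// scale1r -addrA -scalerDl mulrC subrr.
  by rewrite scale0r addr0.
exact: (bic_comb _ _ GA).
Qed.

Lemma refl_minimal A s : reflection A s -> minimal_bicommutant A.
Proof.
move=> rA; split=> [|D /(refl_bic rA)[p [q ->]] nD];
  first exact: refl_nonscalar rA.
apply: comb_bic; apply: contra_notN nD => /eqP ->; exists q.
by rewrite scale0r add0r.
Qed.

(** The partner exchanges, up to factors, an eigenvector [x] for [s] and an eigenvector [y] for
    [-s], and vanishes on the complement of their span. *)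
Lemma refl_antipartner A s : reflection A s -> has_antipartner A.
Proof.
move=> rA; have s0 := refl_neq0 rA.
have [x x0 Ax] := refl_pos rA; have [y y0 Ay] := refl_neg rA.
have xy := refl_orth s0 Ax Ay.
pose B := P (x + y) - P x - P y.
have BE v : B v = '[v, x] *: y + '[v, y] *: x.
  by apply: dot_inj => z; rewrite /B !(bsaE, dotE); ring.
have anti : anticomm B A.
  move=> v; rewrite !BE !bsa_dot Ax Ay !opE Ax Ay.
  by apply: dot_inj => z; rewrite !dotE; ring.
exists B; split=> // h.
have : B (A x) = 0.
  apply/eqP; have := anti x; rewrite -h => /eqP.
  by rewrite -addr_eq0 -mulr2n -scaler_nat scaler_eq0 pnatr_eq0.
rewrite Ax BE !dotZl xy mulr0 cscale0r addr0 => /eqP.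
by rewrite cscaler_eq0 mulf_eq0 rc_eq0 dot_eq0 (negPf s0) (negPf x0) (negPf y0).
Qed.

(* A^2 is in the bicommutant of A and commutes with the partner, so minimality
   forces it to be scalar. *)
Lemma antipartner_refl A : minimal_bicommutant A -> has_antipartner A ->
  exists s, reflection A s.
Proof.
move=> [nA minA] [B [anti nBA]].
have [s2 A2] : is_scalar (bsa_sqr A).
  apply: contrapT => /(minA (bsa_sqr A)) h; apply: nBA; apply: h => [G GA|] v.
    by rewrite !bsaE !GA.
  by rewrite !bsaE !anti opN opprK.
have A2E v : A (A v) = rc s2 *: v by rewrite -bsa_sqrE A2 !bsaE.
have s2_gt0 : 0 < s2.
  have [v Av] : exists v, A v != 0.
    apply: contrapT => h; apply: nA; exists 0; apply: bsaP => v.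
    by rewrite !bsaE cscale0r; apply: contrapT => /eqP ?; apply: h; exists v.
  have v0 : v != 0 by apply: contra_neq Av => ->; rewrite op0.
  have := Av; rewrite -dot_gt0 bsa_dot A2E dotZr conj_rc.
  by rewrite pmulr_lgt0 ?dot_gt0// -rc0 ltr_rc.
pose s := Num.sqrt s2; have s0 : s != 0 by rewrite gt_eqF ?sqrtr_gt0.
have sE : s ^+ 2 = s2 by rewrite sqr_sqrtr ?ltW.
exists s; split => //; first by rewrite sE.
(* Since [A^2 = s^2], each [A v + s v] lies in the [s]-eigenspace; were they all zero, [A] would be
   the scalar [-s]. The other sign is symmetric. *)
- apply: contrapT => h; apply: nA; exists (- s); apply: bsaP => v.
  rewrite !bsaE rcE cscaleNr; apply/eqP; rewrite -addr_eq0; apply/eqP.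
  apply: contrapT => /eqP h'; apply: h; exists (A v + rc s *: v) => //.
  by rewrite !opE A2E -sE expr2 rcE scalerDr cscalerA addrC.
- apply: contrapT => h; apply: nA; exists s; apply: bsaP => v.
  rewrite !bsaE; apply/eqP; rewrite -subr_eq0; apply/eqP.
  apply: contrapT => /eqP h'; apply: h; exists (A v - rc s *: v) => //.
  by rewrite !opE A2E -sE expr2 rcE scalerBr cscalerA opprB.
Qed.

(* If A is a nonzero multiple of 2P_x - I and D a commuting reflection, {A, D}''
   is spanned by A'' and D''.  If both eigenspaces of A have dimension at least
   2, this fails for D = 2(P_x + P_y) - I and E = P_x, with unit vectors x and y
   in different eigenspaces. *)
Definition rank1_like A : Prop :=
  (exists s, reflection A s) /\
  forall D, (exists t, reflection D t) -> comm A D ->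
  forall E, (forall G, comm G A -> comm G D -> comm G E) ->
  exists G, bicommutant D G /\ bicommutant A (E - G).

(** When the [s]-eigenspace is the line of [x], [A] is a combination of [P x] and [I], so both have
    the same commutant. *)
Lemma refl_line A s x : reflection A s -> x != 0 -> A x = rc s *: x ->
  (forall y, A y = rc s *: y -> parallel x y) ->
  forall G, comm G A <-> eig G x.
Proof.
move=> rA x0 Ax line G; have s0 := refl_neq0 rA.
split=> [GA|/comm_proj GP].
  have [|c Gx] := line (G x); last by exists c.
  by rewrite -GA Ax opE.
have [r r0 xx] := dot_real x0.
suff -> : A = (s *+ 2 / r) *: P x + (- s) *: I by exact: bic_comb GP.
apply: bsaP => v; rewrite !bsaE.
have [u [w [-> Au Aw]]] := refl_part v rA; rewrite opE Au Aw.
have [c ->] := line _ Au.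
rewrite dotDl (dot_eq0C (refl_orth s0 Ax Aw)) !dotE xx.
apply: dot_inj => z; rewrite !dotE mulr2n !rcE.
by field; rewrite rc_eq0 gt_eqF.
Qed.

Lemma rank1_likeP A : rank1_like A ->
  exists2 x : H, x != 0 & forall G, comm G A <-> eig G x.
Proof.
move=> [[s rA] hA]; have s0 := refl_neq0 rA; have rA' := reflN rA.
have [x x0 Ax] := refl_pos rA; have [y y0 Ay] := refl_neg rA.
have [|nx] := pselect (forall z, A z = rc s *: z -> parallel x z).
  by move/(refl_line rA x0 Ax); exists x.
have Ay' : A y = rc (- s) *: y by rewrite Ay rcE cscaleNr.
have [|ny] := pselect (forall z, A z = rc (- s) *: z -> parallel y z).
  by move/(refl_line rA' y0 Ay'); exists y.
exfalso.
(* Neither eigenspace is a line, so each contains a second vector orthogonal to the first one. *)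
have [x' [x'0 Ax' xx']] : exists x', [/\ x' != 0, A x' = rc s *: x' & '[x', x]
  = 0].
  apply: contrapT => h; apply: nx => z Az; apply: contrapT => npar.
  have [a [w [zE wx _ w0]]] := perp_part x0 npar; apply: h; exists w;
    split=> //.
  have -> : w = z - a *: x by rewrite zE addrC addKr.
  by rewrite !opE Az Ax scalerBr !cscalerA mulrC.
have [y' [y'0 Ay'' yy']] : exists y', [/\ y' != 0, A y' = - (rc s *: y') &
  '[y', y] = 0].
  apply: contrapT => h; apply: ny => z Az; apply: contrapT => npar.
  have [a [w [zE wx _ w0]]] := perp_part y0 npar; apply: h; exists w;
    split=> //.
  have -> : w = z - a *: y by rewrite zE addrC addKr.
  by apply: dot_inj => t; rewrite !opE Az Ay' !dotE !rcE; ring.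
have xy := refl_orth s0 Ax Ay; have x'y := refl_orth s0 Ax' Ay.
have y'x := dot_eq0C (refl_orth s0 Ax Ay'').
have yx := dot_eq0C xy.
have [a a0 xxE] := dot_real x0; have [b b0 yyE] := dot_real y0.
(* Twice the projection onto the span of [x] and [y], minus [I]: it separates [x], [y] from [x'],
   [y'], while [A] separates [x], [x'] from [y], [y']. *)
pose D := (2 / a) *: P x + (2 / b) *: P y - I.
have ra : rc a != 0 by rewrite rc_eq0 gt_eqF.
have rb : rc b != 0 by rewrite rc_eq0 gt_eqF.
have DE v : D v = (2 / rc a * '[v, x]) *: x + (2 / rc b * '[v, y]) *: y - v.
  by rewrite /D !bsaE !rcE !cscalerA.
have Dx : D x = x.
  rewrite DE xxE xy; apply: dot_inj => z; rewrite !dotE; by field;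
    rewrite !fmorph_eq0 !gt_eqF.
have Dy : D y = y.
  rewrite DE yyE yx; apply: dot_inj => z; rewrite !dotE; by field;
    rewrite !fmorph_eq0 !gt_eqF.
have Dx' : D x' = - x'.
  by rewrite DE xx' x'y !mulr0 !cscale0r !add0r.
have Dy' : D y' = - y'.
  by rewrite DE y'x yy' !mulr0 !cscale0r !add0r.
have rD : reflection D 1.
  split; rewrite ?oner_eq0//.
  - move=> v; rewrite [D v]DE !opE Dx Dy DE expr1n cscale1r.
    by rewrite opprB addrC subrK.
  - by exists x => //; rewrite cscale1r.
  - by exists x' => //; rewrite cscale1r.
have AD : comm A D.
  apply/commC/commB; last by apply/commC; rewrite -[I]scale1r; exact: commI.
  apply: commD; apply: commZ; apply: commC; apply/comm_proj;
    first by exists (rc s).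
  by exists (rc (- s)).
clearbody D.
(* [P x] is a legitimate [E]: if [G] commutes with [A] and [D], then [G x] is fixed by [D] and
   orthogonal to [y], hence a multiple of [x]. *)
have [G GA GD|G [/(refl_bic rD)[p [q GE]] /(refl_bic rA)[p' [q' EE]]]] :=
  hA D (ex_intro _ _ rD) AD (P x).
  apply/comm_proj; exists ((rc a)^-1 * '[G x, x]).
  have Gxy : '[G x, y] = 0 by apply: (refl_orth s0 _ Ay); rewrite -GA Ax opE.
  have : D (G x) = G x by rewrite -GD Dx.
  rewrite DE Gxy mulr0 cscale0r addr0 => h.
  have h' : (2 / rc a * '[G x, x]) *: x = 2 *: G x.
    by rewrite -[LHS](subrK (G x)) h scaler_nat mulr2n.
  apply: (@scalerI _ _ (2 : Cx R)); first by rewrite pnatr_eq0.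
  by rewrite -h' cscalerA mulrA.
(* Now [P x] is a combination of [D], [A] and [I]. Its eigenvalues at [x], [y], [x'], [y'] are [a],
   0, 0, 0, but for any such combination the sum with signs +, -, -, + is 0. *)
have ev z m d e : z != 0 -> '[z, x] *: x = m *: z -> D z = d *: z ->
    A z = e *: z -> m = rc p * d + rc q + (rc p' * e + rc q').
  have h : P x = p *: D + q *: I + (p' *: A + q' *: I).
    by rewrite -EE -GE addrC subrK.
  move=> z0 hm hd he; apply: (cscaler_inj z0).
  by rewrite -hm -bsa_projE h !bsaE hd he !cscalerA !cscalerDl.
have e1 : rc a = rc p * 1 + rc q + (rc p' * rc s + rc q').
  by apply: (ev x); rewrite ?xxE ?Dx ?cscale1r.
have e2 : 0 = rc p * 1 + rc q + (rc p' * (- rc s) + rc q').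
  by apply: (ev y); rewrite ?yx ?Dy ?Ay ?cscale1r ?cscale0r ?cscaleNr.
have e3 : 0 = rc p * -1 + rc q + (rc p' * rc s + rc q').
  by apply: (ev x'); rewrite ?xx' ?Dx' ?cscaleNr ?cscale1r ?cscale0r.
have e4 : 0 = rc p * -1 + rc q + (rc p' * (- rc s) + rc q').
  by apply: (ev y'); rewrite ?y'x ?Dy' ?Ay'' ?cscaleNr ?cscale1r ?cscale0r.
move/eqP: ra; apply.
rewrite e1; transitivity (rc p * 1 + rc q + (rc p' * - rc s + rc q') +
    (rc p * -1 + rc q + (rc p' * rc s + rc q')) -
    (rc p * -1 + rc q + (rc p' * - rc s + rc q'))); first by ring.
by rewrite -e2 -e3 -e4 oppr0 !addr0.
Qed.

(** Choose the sign of [t] so that [D x = t x]. Then [E] is scalar on the line of [x], on the rest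
    of the [t]-eigenspace of [D] and on its [-t]-eigenspace. A combination [G] of [D] and [I]
    matches the last two values, and [E - G] is a multiple of [P x]. *)
Lemma rank1_like_refl A s x : reflection A s -> x != 0 ->
  (forall G, comm G A <-> eig G x) -> rank1_like A.
Proof.
move=> rA x0 hx; split=> [|D [t' rD'] AD E hE]; first by exists s.
have [t rD Dx] : exists2 t : R, reflection D t & D x = rc t *: x.
  have [r Dx] := eig_real ((hx D).1 (commC AD)).
  have /eqP : rc (r ^+ 2) = rc (t' ^+ 2).
    by apply: (cscaler_inj x0); rewrite -(refl_sqr rD') Dx opE Dx cscalerA -rcM.
  rewrite (inj_eq (@rc_inj _)) eqf_sqr => /orP[] /eqP rE.
    by exists t'; rewrite ?Dx ?rE.
  by exists (- t'); [exact: reflN|rewrite -rE].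
have t0 := refl_neq0 rD.
have eE u : '[u, x] = 0 -> eig D u -> eig E u.
  move=> ux Du; apply/comm_proj/commC/hE; last by apply/commC/comm_proj.
  by apply/hx/eig_proj_perp/dot_eq0C.
have [e Ex] : exists r, E x = rc r *: x.
  apply/eig_real/comm_proj/commC/hE; first by apply/hx/eig_proj_self.
  by apply/commC/comm_proj; exists (rc t).
have [u w [Du ux] [Dw wx]|u [Du ux]|p hp] :=
    @eig_common _ _ E (fun u => D u = rc t *: u /\ '[u, x] = 0).
- by rewrite opE Du Dw scalerDr dotE ux wx addr0.
- by apply: eE => //; exists (rc t).
have [u w Du Dw|u Du|q hq] :=
    @eig_common _ _ E (fun u => D u = - (rc t *: u)).
- by rewrite opE Du Dw scalerDr opprD.
- apply: eE; last by exists (- rc t); rewrite Du cscaleNr.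
  exact: dot_eq0C (refl_orth t0 Dx Du).
exists (((p - q) / (t *+ 2)) *: D + ((p + q) / 2) *: I).
split; first exact: bic_comb.
have [r r0 xx] := dot_real x0.
have -> : E - (((p - q) / (t *+ 2)) *: D + ((p + q) / 2) *: I) =
    ((e - p) / r) *: P x.
  apply: bsaP => v; have [u [w [-> Du Dw]]] := refl_part v rD.
  have wx := dot_eq0C (refl_orth t0 Dx Dw).
  pose k := u - ('[u, x] / rc r) *: x.
  have uE : u = ('[u, x] / rc r) *: x + k by rewrite /k addrC subrK.
  have Dk : D k = rc t *: k.
    by rewrite /k !opE Du Dx scalerBr !cscalerA mulrC.
  have kx : '[k, x] = 0 by rewrite /k !dotE xx; field; rewrite rc_eq0 gt_eqF.
  have kE : k = u - ('[u, x] / rc r) *: x by [].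
  clearbody k; rewrite !(bsaE, opE) Du Dw (hq _ Dw) {1}uE !opE Ex.
  rewrite (hp _ (conj Dk kx)) wx {1}kE.
  apply: dot_inj => z; rewrite !dotE !mulr2n !rcE.
  by field; rewrite -mulr2n mulrn_eq0 !fmorph_eq0 t0 gt_eqF.
move=> G /hx /comm_proj GP; apply/commC/commZ/commC/GP.
Qed.
End Reflections.

(** * Separation of rays in dimension at least three *)

Section DimensionThree.
Variables (R : realType) (H : hilbertType R).
Hypothesis hdim : dim_ge H 3.
Local Notation S := (bounded_self_adjoint H).
Local Notation "''[' x , y ]" := (dot x y) : ring_scope.
Local Notation I := (bsa_one H).
Local Notation P := (@bsa_proj R H).
Implicit Types (A B C D E G : S) (x y z u v w : H) (a b : Cx R) (r s t : R).

(** Two linear conditions on the coefficients of three independent vectors have a nonzero solution.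
    The vectors [x] and [y] are arbitrary, possibly equal or zero. *)
Lemma third_vector x y : exists z, [/\ z != 0, '[x, z] = 0 & '[y, z] = 0].
Proof.
have [v vfree] := hdim.
pose M : 'M[Cx R]_(3, 2) :=
  \matrix_(i, j) (if j == ord0 then '[v i, x] else '[v i, y]).
have : kermx M != 0.
  rewrite kermx_eq0 /row_free; apply/eqP => h.
  by have := rank_leq_col M; rewrite h.
case/rowV0Pn => k /sub_kermxP kM k0.
pose z := \sum_(i < 3) k 0 i *: v i.
have zE u : '[z, u] = \sum_(i < 3) k 0 i * '[v i, u].
  rewrite /z; elim/big_ind2 : _ => [|? ? ? ? <- <-|i _]; rewrite ?dotE//.
exists z; split.
- apply: contra_neq k0 => z0; apply/rowP => i; rewrite mxE.
  exact: (vfree _ z0).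
- apply: dot_eq0C; rewrite zE; move/rowP: kM => /(_ ord0); rewrite !mxE => h.
  by rewrite -[RHS]h; apply: eq_bigr => i _; rewrite !mxE.
- apply: dot_eq0C; rewrite zE; move/rowP: kM => /(_ (lift ord0 ord0)).
  rewrite !mxE => h.
  by rewrite -[RHS]h; apply: eq_bigr => i _; rewrite !mxE.
Qed.

(** With [w] the part of [y] orthogonal to [x], and [z] orthogonal to both, [P (w + z)] kills [x]
    but does not have [y] as an eigenvector. In dimension two the ray orthogonal to [x] would be a
    counterexample. *)
Lemma eig_separate x y : x != 0 -> y != 0 ->
  (forall G, eig G x -> eig G y) -> parallel x y.
Proof.
move=> x0 y0 h; apply: contrapT => npar.
have [a [w [yE wx wy w0]]] := perp_part x0 npar.
have [z [z0 xz yz]] := third_vector x y.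
have /(eig_projP y0)[] : eig (P (w + z)) y.
  by apply/h/eig_proj_perp; rewrite dotE xz (dot_eq0C wx) addr0.
  by rewrite dotE (dot_eq0C yz) addr0 => /eqP; rewrite (negPf wy).
case=> c e; move/eqP: z0; apply; apply/eqP; rewrite -dot_eq0.
have wz : '[w, z] = 0.
  have -> : w = y - a *: x by rewrite yE addrC addKr.
  by rewrite !dotE xz yz mulr0 subrr.
by have := congr1 (fun u => '[u, z]) e; rewrite !dotE wz yz add0r mulr0 => ->.
Qed.

(** Evaluate at a vector orthogonal to both, then at one orthogonal to [x] only, then at [x]: the
    scalar, [s] and [r] vanish in turn. *)
Lemma proj_indep x y r s : x != 0 -> y != 0 -> ~ parallel x y ->
  is_scalar (r *: P x + s *: P y) -> r = 0 /\ s = 0.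
Proof.
move=> x0 y0 npar [c e].
have [a [w [_ wx wy w0]]] := perp_part x0 npar.
have [z [z0 xz yz]] := third_vector x y.
have c0 : c = 0.
  have := congr1 (fun A : S => A z) e;
    rewrite !bsaE (dot_eq0C xz) (dot_eq0C yz).
  rewrite !cscale0r !scaler0 addr0 => /esym/eqP.
  by rewrite cscaler_eq0 (negPf z0) orbF rc_eq0 => /eqP.
rewrite c0 scale0r in e.
have s0 : s = 0.
  have := congr1 (fun A : S => A w) e; rewrite !bsaE wx.
  rewrite cscale0r scaler0 add0r cscalerA => /eqP.
  by rewrite cscaler_eq0 (negPf y0) orbF mulf_eq0 (negPf wy) orbF rc_eq0 =>
    /eqP.
split=> //.
have := congr1 (fun A : S => A x) e; rewrite !bsaE s0 rc0 cscale0r addr0.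
rewrite cscalerA => /eqP.
by rewrite cscaler_eq0 (negPf x0) orbF mulf_eq0 dot_eq0 (negPf x0) orbF rc_eq0
  => /eqP.
Qed.

End DimensionThree.

(** * Commutation properties preserved by phi *)

Section Preserver.
Variables (R : realType) (H : hilbertType R).
Local Notation S := (bounded_self_adjoint H).
Local Notation "''[' x , y ]" := (dot x y) : ring_scope.
Local Notation I := (bsa_one H).
Local Notation P := (@bsa_proj R H).
Implicit Types (A B C D E G : S) (x y z u v w : H) (a b : Cx R) (r s t : R).

Definition quasicomm A B : Prop := comm A B \/ anticomm A B.

(** Test against each [P x]: anticommuting with [P x], like commuting with it, makes [x] an
    eigenvector. *)
Lemma quasicomm_scalar A : (forall C, quasicomm A C) -> is_scalar A.
Proof.
move=> h; apply: scalar_eig => x; case: (h (P x)) => [/comm_proj//|/(_ x)].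
have [->|x0] := eqVneq x 0; first by exists 0; rewrite op0 scaler0.
rewrite !bsaE opE => e; exists (- '[A x, x] / '[x, x]).
rewrite mulrC -cscalerA cscaleNr -e cscalerA mulVf ?cscale1r//.
by rewrite dot_eq0.
Qed.

Lemma anticommC A B : anticomm A B -> anticomm B A.
Proof. by move=> h x; rewrite h opprK. Qed.

Lemma quasicommC A B : quasicomm A B -> quasicomm B A.
Proof. by case=> [/commC|/anticommC]; [left|right]. Qed.

(* If both A and A + I anticommute with C, then C = 0. *)
Lemma comm_shift A C : comm A C <-> forall r, quasicomm (A + r *: I) C.
Proof.
split=> [AC r|h].
  by left; apply: commD => //; apply/commC/commI.
case: (h 0) => [|]; rewrite scale0r addr0// => anti0.
case: (h 1) => [h1 x|anti1 x].
  by have := h1 x; rewrite !(bsaE, opE) !cscale1r => /addIr.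
suff C0 y : C y = 0 by rewrite !C0 op0.
have := anti1 y; rewrite !(bsaE, opE) !cscale1r anti0 opprD => /addrI /eqP.
by rewrite -addr_eq0 -mulr2n -scaler_nat scaler_eq0 pnatr_eq0 => /eqP.
Qed.

Lemma is_scalarD A B : is_scalar A -> is_scalar B -> is_scalar (A + B).
Proof. by case=> r -> [s ->]; exists (r + s); rewrite scalerDl. Qed.

Lemma is_scalarZ r A : is_scalar A -> is_scalar (r *: A).
Proof. by case=> s ->; exists (r * s); rewrite scalerA. Qed.

Lemma is_scalarN A : is_scalar A -> is_scalar (- A).
Proof. by rewrite -scaleN1r; exact: is_scalarZ. Qed.

Lemma is_scalarB A B : is_scalar A -> is_scalar B -> is_scalar (A - B).
Proof. by move=> hA hB; apply: is_scalarD => //; apply: is_scalarN. Qed.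

Lemma comm_scalar A B : is_scalar B -> comm A B.
Proof. by case=> r ->; exact: commI. Qed.

Variable phi : S -> S.
Hypothesis hsurj : forall Y, exists X, phi X = Y.
Hypothesis hphi : forall A B C,
  quasicomm (A - B) C <-> quasicomm (phi A - phi B) (phi C).

Lemma phi_scalar_sub A B : is_scalar (A - B) <-> is_scalar (phi A - phi B).
Proof.
split=> h; apply: quasicomm_scalar => C.
  have [D <-] := hsurj C; apply: (hphi _ _ _).1; left; apply: commC;
    exact: comm_scalar.
by apply: (hphi _ _ _).2; left; apply: commC; apply: comm_scalar.
Qed.

(** Choose [A] with [phi A = C + phi 0]; since [A - 0] commutes with 0, [C] quasi-commutes with
    [phi 0]. *)
Lemma phi_zero_scalar : is_scalar (phi 0).
Proof.
apply: quasicomm_scalar => C; apply: quasicommC.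
have [A hA] := hsurj (C + phi 0).
have -> : C = phi A - phi 0 by rewrite hA addrK.
by apply: (hphi _ _ _).1; left; apply: comm_scalar; exists 0; rewrite scale0r.
Qed.

(** By surjectivity [phi A + r I] is some [phi A'], and then [A' - A] is scalar. Thus the shifts in
    [comm_shift] on one side correspond to scalar shifts on the other. *)
Lemma phi_comm_sub A B C :
  comm (A - B) C <-> comm (phi A - phi B) (phi C).
Proof.
split=> h; apply/comm_shift => r.
  have [A' hA'] := hsurj (phi A + r *: I).
  rewrite addrAC -hA'; apply: (hphi _ _ _).1; left.
  rewrite -[A'](subrK A) -addrA; apply: commD => //.
  apply/commC/comm_scalar; apply: (phi_scalar_sub _ _).2; rewrite hA'.
  by exists r; rewrite addrC addKr.
rewrite addrAC; apply: (hphi _ _ _).2; left.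
rewrite -[phi (A + _)](subrK (phi A)) -addrA; apply: commD => //.
apply/commC/comm_scalar; apply: (phi_scalar_sub _ _).1.
by exists r; rewrite addrC addKr.
Qed.

Lemma phi_comm A C : comm A C <-> comm (phi A) (phi C).
Proof.
rewrite -{1}[A]subr0 phi_comm_sub; split=> h.
  rewrite -[phi A](subrK (phi 0)); apply: commD => //.
  by apply: commC; apply: comm_scalar; exact: phi_zero_scalar.
by apply: commB => //; by apply: commC; apply: comm_scalar;
  exact: phi_zero_scalar.
Qed.

Lemma phi_scalar A : is_scalar A <-> is_scalar (phi A).
Proof.
have h := phi_scalar_sub A 0; rewrite subr0 in h; rewrite h.
have h0 := phi_zero_scalar; split=> hA; last exact: is_scalarB.
by rewrite -[phi A](subrK (phi 0)); apply: is_scalarD.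
Qed.

Lemma phi_bicommutant A D :
  bicommutant A D <-> bicommutant (phi A) (phi D).
Proof.
split=> h G; last by move=> GA; apply: (phi_comm _ _).2 (h _ ((phi_comm _ _).1
  GA)).
have [K <-] := hsurj G => KA.
exact: (phi_comm _ _).1 (h _ ((phi_comm _ _).2 KA)).
Qed.

(** This sends each coset of {A}'' into a coset of {phi A}''. Differences are taken outside [phi],
    which is not yet known to be additive. *)
Lemma phi_bicommutant_sub A D E :
  bicommutant A (D - E) <-> bicommutant (phi A) (phi D - phi E).
Proof.
split=> h G.
  have [K <-] := hsurj G => /(phi_comm _ _).2/h KDE.
  exact/commC/((phi_comm_sub _ _ _).1)/commC.
by move=> /(phi_comm _ _).1/h KDE; apply/commC/((phi_comm_sub _ _ _).2)/commC.
Qed.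

Lemma phi_minimal A : minimal_bicommutant A <-> minimal_bicommutant (phi A).
Proof.
split=> -[nA hA]; split.
- by move/((phi_scalar _).2).
- move=> D; have [E <-] := hsurj D => /(phi_bicommutant _ _).2/hA h nE.
  by apply/((phi_bicommutant _ _).1)/h => /((phi_scalar _).1).
- by move/((phi_scalar _).1).
- move=> D /(phi_bicommutant _ _).1/hA h nD.
  by apply/((phi_bicommutant _ _).2)/h => /((phi_scalar _).2).
Qed.

(** The partner of [phi A] is [phi B - phi 0]: quasi-commutation is preserved and commutation is
    excluded by [phi_comm_sub], so anticommutation remains. *)
Lemma phi_antipartner A : has_antipartner A <-> has_antipartner (phi A).
Proof.
have e B : B - 0 = B by rewrite subr0.
split=> -[B [anti ncomm]].
  exists (phi B - phi 0); have ncomm' : ~ comm (phi B - phi 0) (phi A).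
    by move/(phi_comm_sub _ _ _).2; rewrite e.
  split=> //; have /(hphi _ _ _).1[] : quasicomm (B - 0) A by rewrite e; right.
    by [].
  by [].
have [C hC] := hsurj (B + phi 0).
have {}hC : B = phi C - phi 0 by rewrite hC addrK.
rewrite {}hC in anti ncomm.
have ncomm' : ~ comm C A by rewrite -[C]e => /(phi_comm_sub _ _ _).1.
exists C; split=> //.
have /(hphi _ _ _).2 : quasicomm (phi C - phi 0) (phi A) by right.
by rewrite e => -[].
Qed.

Lemma phi_reflection A :
  (exists s, reflection A s) <-> (exists s, reflection (phi A) s).
Proof.
split=> -[s rA]; apply: antipartner_refl.
- exact: (phi_minimal _).1 (refl_minimal rA).
- exact: (phi_antipartner _).1 (refl_antipartner rA).
- exact: (phi_minimal _).2 (refl_minimal rA).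
- exact: (phi_antipartner _).2 (refl_antipartner rA).
Qed.

Lemma phi_rank1_like A : rank1_like A <-> rank1_like (phi A).
Proof.
split=> -[rA hA]; split; first exact: (phi_reflection _).1.
- move=> D; have [D' <-] := hsurj D.
  move=> /(phi_reflection _).2 rD /(phi_comm _ _).2 AD E.
  have [E' <-] := hsurj E => hE.
  have [|G [DG AEG]] := hA D' rD AD E'.
    move=> G GA GD; apply: (phi_comm _ _).2; apply: hE;
      exact: (phi_comm _ _).1.
  exists (phi G); split; first exact: (phi_bicommutant _ _).1.
  exact: (phi_bicommutant_sub _ _ _).1.
- exact: (phi_reflection _).2.
move=> D /(phi_reflection _).1 rD /(phi_comm _ _).1 AD E hE.
have [|G' [DG AEG]] := hA (phi D) rD AD (phi E).
  move=> G; have [G' <-] := hsurj G => GA GD.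
  by apply: (phi_comm _ _).1; apply: hE; exact: (phi_comm _ _).2.
have [G GE] := hsurj G'; rewrite -GE in DG AEG.
exists G; split; first exact: (phi_bicommutant _ _).2.
exact: (phi_bicommutant_sub _ _ _).2.
Qed.

End Preserver.

(** * Rank-one projections and their bicommutants *)

Section RankOne.
Variables (R : realType) (H : hilbertType R).
Hypothesis hdim : dim_ge H 3.
Local Notation S := (bounded_self_adjoint H).
Local Notation "''[' x , y ]" := (dot x y) : ring_scope.
Local Notation I := (bsa_one H).
Local Notation P := (@bsa_proj R H).
Implicit Types (A B C D E G : S) (x y z u v w : H) (a b : Cx R) (r s t : R).

(** [W] is the reflection fixing [x] and negating its orthogonal complement; through it the results
    on reflections apply to [P x]. *)
Lemma proj_reflection x : x != 0 -> exists W p q,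
  [/\ reflection W 1, W = p *: P x + q *: I & forall G, comm G W <-> eig G x].
Proof.
move=> x0; have [r r0 xx] := dot_real x0.
have [z [z0 xz _]] := third_vector hdim x x.
pose W := (2 / r) *: P x + (-1) *: I; exists W, (2 / r), (-1).
have r0' : rc r != 0 by rewrite rc_eq0 gt_eqF.
have WE v : W v = (2 / rc r * '[v, x]) *: x - v.
  by rewrite /W !bsaE !rcE cscalerA.
have Wx : W x = x.
  rewrite WE xx; apply: dot_inj => u; rewrite !dotE.
  by field; rewrite fmorph_eq0 gt_eqF.
split=> // [|G].
- split; rewrite ?oner_eq0//.
  + move=> v; rewrite [W v]WE !opE Wx WE expr1n cscale1r.
    by rewrite opprB addrC subrK.
  + by exists x => //; rewrite cscale1r.
  + exists z => //; rewrite WE (dot_eq0C xz) mulr0 cscale0r add0r.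
    by rewrite cscale1r.
- split=> [|/comm_proj]; last exact: bic_comb.
  move=> GW; apply/comm_proj; apply: (@comb_bic _ _ _ (2 / r) (-1)) GW.
  by rewrite mulf_neq0 ?invr_neq0 ?pnatr_eq0 ?gt_eqF.
Qed.

Lemma proj_bic y D : y != 0 -> bicommutant (P y) D ->
  exists g, is_scalar (D - g *: P y).
Proof.
move=> y0 hD; have [W [p [q [rW WE hW]]]] := proj_reflection y0.
have [|p' [q' DE]] := refl_bic rW (D := D).
  by move=> G /hW/comm_proj/hD.
exists (p' * p), (p' * q + q'); rewrite DE WE.
by apply: bsa_ext => v w; rewrite !(bsaE, dotE) !rcE; ring.
Qed.

Lemma proj_scalar y r : y != 0 -> is_scalar (r *: P y) -> r = 0.
Proof.
move=> y0 [c e]; have [z [z0 yz _]] := third_vector hdim y y.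
have c0 : c = 0.
  have := congr1 (fun A : S => A z) e; rewrite !bsaE (dot_eq0C yz).
  rewrite !cscale0r !scaler0 => /esym/eqP.
  by rewrite cscaler_eq0 (negPf z0) orbF rc_eq0 => /eqP.
have := congr1 (fun A : S => A y) e; rewrite !bsaE c0 rc0 cscale0r cscalerA.
move=> /eqP.
by rewrite cscaler_eq0 (negPf y0) orbF mulf_eq0 dot_eq0 (negPf y0) orbF rc_eq0
  => /eqP.
Qed.

Lemma proj_parallel x y r s : y != 0 -> parallel y x -> '[x, x] = rc r ->
  '[y, y] = rc s -> s *: P x = r *: P y.
Proof.
move=> y0 [a ->]; rewrite !dotE => rE sE.
apply: bsa_ext => v w; rewrite !(bsaE, dotE) -rE -sE; ring.
Qed.

Lemma orth_not_parallel x y : x != 0 -> '[x, y] = 0 -> y != 0 -> ~ parallel x y.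
Proof.
move=> x0 xy y0 [a ya]; move/eqP: xy; rewrite ya dotE mulf_eq0 dot_eq0.
rewrite (negPf x0) orbF conjC_eq0 => /eqP a0.
by move/eqP: y0; apply; rewrite ya a0 cscale0r.
Qed.

Lemma unit_vector x : x != 0 -> exists r u,
  [/\ 0 < r, '[u, u] = 1, x = rc r *: u & '[x, x] = rc (r ^+ 2)].
Proof.
move=> x0; have [s s0 xx] := dot_real x0.
have r0 : 0 < Num.sqrt s by rewrite sqrtr_gt0.
have e : rc (Num.sqrt s) * rc (Num.sqrt s) = rc s.
  by rewrite -rcM -expr2 sqr_sqrtr ?ltW.
have rr : rc (Num.sqrt s) != 0 by rewrite rc_eq0 gt_eqF.
exists (Num.sqrt s), ((rc (Num.sqrt s))^-1 *: x); split=> //.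
- by rewrite !dotE xx -e; field; rewrite fmorph_eq0 gt_eqF.
- by rewrite cscalerA mulfV// cscale1r.
- by rewrite sqr_sqrtr ?ltW.
Qed.

Lemma unit_neq0 u : '[u, u] = 1 -> u != 0.
Proof. by rewrite -dot_eq0 => ->; rewrite oner_eq0. Qed.

End RankOne.

(** * The induced map on rays *)

Section RayMap.
Variables (R : realType) (H : hilbertType R).
Hypothesis hdim : dim_ge H 3.
Local Notation S := (bounded_self_adjoint H).
Local Notation "''[' x , y ]" := (dot x y) : ring_scope.
Local Notation I := (bsa_one H).
Local Notation P := (@bsa_proj R H).
Implicit Types (A B C D E G : S) (x y z u v w : H) (a b : Cx R) (r s t : R).
Variable phi : S -> S.
Hypothesis hsurj : forall Y, exists X, phi X = Y.
Hypothesis hphi : forall A B C,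
  quasicomm (A - B) C <-> quasicomm (phi A - phi B) (phi C).

Let phi_comm := phi_comm hsurj hphi.

Lemma phi_line x : x != 0 ->
  exists2 y, y != 0 & forall G, comm G (phi (P x)) <-> eig G y.
Proof.
move=> x0; have [W [p [q [rW WE hW]]]] := proj_reflection hdim x0.
have /(phi_rank1_like hsurj hphi _).1/rank1_likeP[y y0 hy] :=
  rank1_like_refl rW x0 hW.
exists y => // G; rewrite -hy; have [K <-] := hsurj G.
by rewrite -!phi_comm hW comm_proj.
Qed.

Lemma phi_line_surj y : y != 0 ->
  exists2 x, x != 0 & forall G, comm G (phi (P x)) <-> eig G y.
Proof.
move=> y0; have [W [p [q [rW WE hW]]]] := proj_reflection hdim y0.
have [A AE] := hsurj W.
have := rank1_like_refl rW y0 hW; rewrite -AE.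
move=> /(phi_rank1_like hsurj hphi _).2/rank1_likeP[x x0 hx].
exists x => // G; rewrite -hW -AE; have [K <-] := hsurj G.
by rewrite -!phi_comm hx comm_proj.
Qed.

(** The value [T x] matters only up to a phase: its norm is fixed and the second clause determines
    its ray. Values at parallel vectors are chosen independently. *)
Definition represents (T : H -> H) : Prop :=
  forall x, '[T x, T x] = '[x, x] /\
    forall G, comm G (phi (P x)) <-> eig G (T x).

Lemma eig_scale G x a : a != 0 -> eig G (a *: x) <-> eig G x.
Proof.
move=> a0; split; last exact: eigZ.
by move/(@eigZ _ _ _ _ a^-1); rewrite cscalerA mulVf// cscale1r.
Qed.

Lemma ray_map_exists : exists T, represents T.
Proof.
suff /choice[T hT] : forall x, exists y, '[y, y] = '[x, x] /\
    forall G, comm G (phi (P x)) <-> eig G y by exists T.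
move=> x; have [->|x0] := eqVneq x 0.
  exists 0; split=> // G; split=> _; first by exists 0; rewrite op0 scaler0.
  apply: comm_scalar; have -> : P 0 = 0.
    by apply: bsaP => v; rewrite !bsaE scaler0.
  exact: (phi_zero_scalar hsurj hphi).
have [y y0 hy] := phi_line x0.
have [r [u [r0 uu yE _]]] := unit_vector y0.
have [s [v [s0 vv xE xx]]] := unit_vector x0.
exists (rc s *: u); split; first by rewrite !dotE uu xx expr2 rcM; ring.
move=> G; rewrite hy yE !eig_scale// rc_eq0 gt_eqF//.
Qed.

Section Representative.
Variable T : H -> H.
Hypothesis hT : represents T.

Lemma ray_dot x : '[T x, T x] = '[x, x]. Proof. exact: (hT x).1. Qed.

Lemma ray_neq0 x : x != 0 -> T x != 0.
Proof. by rewrite -!dot_eq0 ray_dot. Qed.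

Lemma ray_eig A x : comm (phi A) (phi (P x)) <-> eig (phi A) (T x).
Proof. exact: (hT x).2. Qed.

Lemma ray_eigP A x : eig (phi A) (T x) <-> eig A x.
Proof. by rewrite -ray_eig -phi_comm comm_proj. Qed.

Lemma ray_comm x z : comm (P x) (P z) <-> comm (P (T x)) (P (T z)).
Proof.
rewrite phi_comm ray_eig -comm_proj; split=> h; apply/commC.
  by apply/comm_proj/(hT x).2/commC.
by apply/(hT x).2/comm_proj/commC.
Qed.

(** By [eig_separate] a ray is determined by the operators having it as an eigenvector, and
    [ray_eigP] transports that family. *)
Lemma ray_parallel x z : x != 0 -> z != 0 ->
  parallel x z <-> parallel (T x) (T z).
Proof.
move=> x0 z0; split=> -[a az].
  have a0 : a != 0 by apply: contra_neq z0 => a0; rewrite az a0 cscale0r.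
  apply: eig_separate; rewrite ?ray_neq0// => G.
  have [K <-] := hsurj G; rewrite !ray_eigP az => h.
  by rewrite eig_scale.
have a0 : a != 0.
  by apply: contra_neq (ray_neq0 z0) => a0; rewrite az a0 cscale0r.
apply: eig_separate => // G /ray_eigP h; apply/ray_eigP.
by rewrite az eig_scale.
Qed.

(** Commuting rank-one projections have orthogonal or parallel rays; commutation is preserved, and
    [ray_parallel] excludes the second case. *)
Lemma ray_orth x z : '[x, z] = 0 -> '[T x, T z] = 0.
Proof.
have [->|x0] := eqVneq x 0.
  by move=> _; apply/eqP; have /eqP := ray_dot 0;
    rewrite dot0l dot_eq0 => /eqP ->;
    rewrite dot0l.
have [->|z0] := eqVneq z 0.
  by move=> _; apply/eqP; have /eqP := ray_dot 0;
    rewrite dot0l dot_eq0 => /eqP ->;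
    rewrite dot0r.
move=> xz; have /comm_proj/(ray_comm _ _).1/comm_proj : eig (P x) z.
  exact/eig_proj_perp/dot_eq0C.
case/(eig_projP (ray_neq0 z0)) => // h.
case: (orth_not_parallel z0 (dot_eq0C xz) x0).
exact: (ray_parallel z0 x0).2 h.
Qed.

Lemma ray_orthV x z : x != 0 -> z != 0 -> '[T x, T z] = 0 -> '[x, z] = 0.
Proof.
move=> x0 z0 Txz; have /comm_proj/(ray_comm _ _).2/comm_proj : eig (P (T x)) (T
  z).
  exact/eig_proj_perp/dot_eq0C.
case/(eig_projP z0) => // h.
case: (orth_not_parallel (ray_neq0 z0) (dot_eq0C Txz) (ray_neq0 x0)).
exact: (ray_parallel z0 x0).1 h.
Qed.

Lemma ray_surj y : y != 0 -> exists2 x, x != 0 & parallel (T x) y.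
Proof.
move=> y0; have [x x0 hx] := phi_line_surj y0; exists x => //.
by apply: eig_separate; rewrite ?ray_neq0// => G /(hT x).2/hx.
Qed.

Lemma phi_dir A B x : x != 0 -> bicommutant (P x) (A - B) ->
  exists g, is_scalar (phi A - phi B - g *: P (T x)).
Proof.
move=> x0 h; apply: proj_bic; rewrite ?ray_neq0// => G /comm_proj/(hT x).2.
exact: (phi_bicommutant_sub hsurj hphi _ _ _).1.
Qed.

Lemma phi_dirD A s x : x != 0 ->
  exists g, is_scalar (phi (A + s *: P x) - phi A - g *: P (T x)).
Proof.
move=> x0; apply: phi_dir => // G GP; rewrite addrC addKr.
exact/commC/commZ/commC.
Qed.

End Representative.
End RayMap.

(** The sign condition makes [h = F / F 1] nonnegative on nonnegative reals, hence monotone; a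
    monotone additive function with [h 1 = 1] is the identity. *)
Lemma additive_pos_linear (R : realType) (F : R -> R) :
  (forall s t, F (s + t) = F s + F t) ->
  (forall s t : R, 0 < s -> 0 < t -> 0 <= F s * F t) -> F 1 != 0 ->
  forall s, F s = F 1 * s.
Proof.
move=> FD F0 F1; pose h s := F s / F 1.
have hD s t : h (s + t) = h s + h t by rewrite /h FD mulrDl.
have h1 : h 1 = 1 by rewrite /h divff.
have hz : h 0 = 0 by have := hD 0 0; rewrite addr0 => /eqP; rewrite -subr_eq0
  opprD addrA subrr add0r oppr_eq0 => /eqP.
have hN s : h (- s) = - h s.
  by apply/eqP; rewrite -addr_eq0 -hD addNr hz.
have hB s t : h (s - t) = h s - h t by rewrite hD hN.
have hMn n s : h (s *+ n) = h s *+ n.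
  by elim: n => [|n IH]; rewrite ?mulr0n// !mulrS hD IH.
have h0 (s : R) : 0 <= s -> 0 <= h s.
  rewrite le_eqVlt => /orP[/eqP <-|s0]; first by rewrite hz.
  have := F0 s 1 s0 ltr01; rewrite /h => hs.
  have -> : F s / F 1 = F s * F 1 / F 1 ^+ 2 by field.
  by rewrite divr_ge0// sqr_ge0.
have hint (m : int) : h m%:~R = m%:~R.
  by case: m => n; rewrite ?NegzE ?mulrNz ?hN -pmulrn hMn h1.
suff hs s : h s = s by move=> s; rewrite -{2}(hs s) /h; field.
apply/eqP; rewrite -subr_eq0; apply: contrapT => /negP d0.
have d0' : 0 < `|h s - s| by rewrite normr_gt0.
(* [n] times the deviation at [s] exceeds 1, yet it equals the deviation at the fractional part [e]
   of [n s], where both [e] and [h e] lie between 0 and 1. *)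
pose n := (Num.truncn `|h s - s|^-1).+1.
have nd : 1 < `|h s - s| *+ n.
  rewrite -mulr_natr -ltr_pdivrMl// mulr1.
  by apply: truncnS_gt.
pose m := Num.floor (s *+ n).
have := floor_itv (s *+ n); rewrite -/m => /andP[m1 m2].
pose e := s *+ n - m%:~R.
have e0 : 0 <= e by rewrite subr_ge0.
have e1 : e <= 1 by rewrite /e; move: m2; rewrite intrD; lra.
have he0 := h0 _ e0.
have he1 : h e <= 1 by rewrite -subr_ge0 -h1 -hB h0// subr_ge0.
have : `|h e - e| <= 1 by rewrite ler_norml; lra.
have -> : h e - e = (h s - s) *+ n.
  by rewrite /e hB hMn hint mulrnBl; ring.
by rewrite normrMn leNgt nd.
Qed.

(** * Linearity on the span of the rank-one projections *)

Section Coefficients.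
Variables (R : realType) (H : hilbertType R).
Hypothesis hdim : dim_ge H 3.
Local Notation S := (bounded_self_adjoint H).
Local Notation "''[' x , y ]" := (dot x y) : ring_scope.
Local Notation I := (bsa_one H).
Local Notation P := (@bsa_proj R H).
Implicit Types (A B C D E G : S) (x y z u v w : H) (a b : Cx R) (r s t : R).
Variable phi : S -> S.
Hypothesis hsurj : forall Y, exists X, phi X = Y.
Hypothesis hphi : forall A B C,
  quasicomm (A - B) C <-> quasicomm (phi A - phi B) (phi C).
Variable T : H -> H.
Hypothesis hT : represents phi T.

Let phi0 := phi_zero_scalar hsurj hphi.
Let T_neq0 x : x != 0 -> T x != 0. Proof. exact: ray_neq0. Qed.

Lemma is_scalar_ext A B : is_scalar A ->
  (forall v w, '[A v, w] = '[B v, w]) -> is_scalar B.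
Proof. by move=> hA /bsa_ext <-. Qed.

Lemma coef_exists : exists f : H -> R -> R, forall x s, x != 0 ->
  is_scalar (phi (s *: P x) - f x s *: P (T x)).
Proof.
suff /choice[f hf] : forall xs : H * R, exists g, xs.1 != 0 ->
    is_scalar (phi (xs.2 *: P xs.1) - g *: P (T xs.1)).
  by exists (fun x s => f (x, s)) => x s; exact: (hf (x, s)).
case=> x s /=; have [->|x0] := eqVneq x 0; first by exists 0 => /eqP.
have [g hg] := phi_dirD hdim hsurj hphi hT 0 s x0.
exists g => _; rewrite add0r in hg.
by have := is_scalarD hg phi0; rewrite addrAC subrK.
Qed.

Section Functions.
Variable f : H -> R -> R.
Hypothesis hf : forall x s, x != 0 ->
  is_scalar (phi (s *: P x) - f x s *: P (T x)).

(** Steps in the direction [P x] have the same coefficient starting from [A] as starting from 0. *)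
Definition translation A x : Prop :=
  forall s, is_scalar (phi (A + s *: P x) - phi A - f x s *: P (T x)).

Lemma translation0 x : x != 0 -> translation 0 x.
Proof.
by move=> x0 s; have := is_scalarB (hf s x0) phi0; rewrite add0r addrAC.
Qed.

(* Go around the parallelogram A, A + s P_x, A + s P_x + t P_y, A + t P_y in
  both
   directions and compare coefficients of P_(Tx). *)
Lemma translation_step A x y t : x != 0 -> y != 0 -> ~ parallel x y ->
  translation A x -> translation (A + t *: P y) x.
Proof.
move=> x0 y0 npar hA s.
have [h hh] := phi_dirD hdim hsurj hphi hT A t y0.
have [g hg] := phi_dirD hdim hsurj hphi hT (A + t *: P y) s x0.
have [h' hh'] := phi_dirD hdim hsurj hphi hT (A + s *: P x) t y0.
rewrite (addrAC A) in hh'.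
have Tpar : ~ parallel (T x) (T y).
  by move/(ray_parallel hdim hsurj hphi hT x0 y0).2.
have [] := @proj_indep _ _ hdim _ _ (g - f x s) (h - h') (T_neq0 x0) (T_neq0
  y0) Tpar.
  have := is_scalarB (is_scalarD (hA s) hh') (is_scalarD hh hg).
  congr is_scalar; apply: bsa_ext => v w; rewrite !(bsaE, dotE) !rcE; ring.
by move=> /eqP; rewrite subr_eq0 => /eqP <-.
Qed.

(** Turns a relation modulo scalars into an exact one, with [z] orthogonal to all vectors
    involved. *)
Lemma lift_eq (X : S) z : T z != 0 -> X (T z) = 0 -> is_scalar X -> X = 0.
Proof.
move=> z0 Xz [r e]; move/eqP: Xz; rewrite e !bsaE cscaler_eq0 (negPf z0) orbF.
by rewrite rc_eq0 => /eqP ->; rewrite scale0r.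
Qed.

(** By [P u + P v = 2 p^2 P x + 2 q^2 P y], one operator is reached from 0 by two different pairs of
    steps; the two expansions of its image agree modulo scalars, and exactly by [lift_eq]. *)
Lemma sum_rel x y u v p q s : '[x, x] = 1 -> '[y, y] = 1 -> '[x, y] = 0 ->
  p != 0 -> q != 0 -> p ^+ 2 + q ^+ 2 = 1 ->
  u = rc p *: x + rc q *: y -> v = rc p *: x - rc q *: y ->
  f u s *: P (T u) + f v s *: P (T v) =
  f x (2 * p ^+ 2 * s) *: P (T x) + f y (2 * q ^+ 2 * s) *: P (T y).
Proof.
move=> xx yy xy p0 q0 pq uE vE; have yx := dot_eq0C xy.
have x0 := unit_neq0 xx; have y0 := unit_neq0 yy.
have pq1 : rc p * rc p + rc q * rc q = 1 by rewrite -!rcM -rcD -!expr2 pq.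
have uu : '[u, u] = 1.
  by rewrite uE !dotE xx yy xy yx !mulr0 addr0 add0r !mulr1.
have vv : '[v, v] = 1.
  by rewrite vE !dotE xx yy xy yx !mulr0 oppr0 addr0 add0r mulrN opprK !mulr1.
have u0 := unit_neq0 uu; have v0 := unit_neq0 vv.
have uv : ~ parallel u v.
  case=> a e; have := congr1 (fun w => '[w, x]) e.
  have := congr1 (fun w => '[w, y]) e.
  rewrite uE vE !dotE xx yy xy yx !mulr0 !mulr1 oppr0 !addr0 !add0r => e1 e2.
  have a1 : a = 1.
    have p0' : rc p != 0 by rewrite rc_eq0.
    by apply: (mulIf p0'); rewrite -e2 mul1r.
  move: e1; rewrite a1 mul1r => /eqP; rewrite eq_sym -subr_eq0 opprK -mulr2n.
  by rewrite mulrn_eq0 /= rc_eq0 (negPf q0).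
have Pe : s *: P v + s *: P u =
    (2 * q ^+ 2 * s) *: P y + (2 * p ^+ 2 * s) *: P x.
  by apply: bsa_ext => w z; rewrite uE vE !(bsaE, dotE) !expr2 !rcE; ring.
have [z [z0 xz yz]] := third_vector hdim x y.
have yx' : ~ parallel x y by exact: orth_not_parallel.
have := is_scalarB (is_scalarD (translation_step s u0 v0 uv (translation0 u0) s)
    (hf s v0))
  (is_scalarD (translation_step (2 * q ^+ 2 * s) x0 y0 yx' (translation0 x0)
    (2 * p ^+ 2 * s)) (hf (2 * q ^+ 2 * s) y0)).
rewrite !add0r Pe => hsc; apply/esym/eqP; rewrite -subr_eq0; apply/eqP.
have To w : '[w, z] = 0 -> '[T z, T w] = 0.
  by move=> wz; apply: (ray_orth hdim hsurj hphi hT); exact: dot_eq0C.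
apply: (@lift_eq _ z); first exact: T_neq0.
  have uz : '[u, z] = 0 by rewrite uE !dotE xz yz !mulr0 addr0.
  have vz : '[v, z] = 0 by rewrite vE !dotE xz yz !mulr0 subr0.
  rewrite !bsaE (To _ xz) (To _ yz) (To _ uz) (To _ vz).
  by rewrite !cscale0r !scaler0 !addr0 subr0.
by apply: (is_scalar_ext hsc) => w w'; rewrite !(bsaE, dotE); ring.
Qed.

(** Take [sum_rel] with [p = q = 1/sqrt 2], where [u] and [v] are orthogonal. Evaluated at [T u] and
    paired with [T x] and [T y], it gives [f u s = f x s] and [f u s = f y s]. *)
Lemma coef_orth x y s : '[x, x] = 1 -> '[y, y] = 1 -> '[x, y] = 0 ->
  f x s = f y s.
Proof.
move=> xx yy xy; have yx := dot_eq0C xy.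
have x0 := unit_neq0 xx; have y0 := unit_neq0 yy.
pose p : R := Num.sqrt 2^-1.
have p0 : p != 0 by rewrite gt_eqF// sqrtr_gt0 invr_gt0.
have pp : p ^+ 2 = 2^-1 by rewrite sqr_sqrtr// invr_ge0.
have pp1 : p ^+ 2 + p ^+ 2 = 1 by rewrite pp; field.
pose u := rc p *: x + rc p *: y; pose v := rc p *: x - rc p *: y.
have := sum_rel s xx yy xy p0 p0 pp1 (erefl u) (erefl v); rewrite pp.
rewrite mulfV ?pnatr_eq0// mul1r => e.
have uv : '[u, v] = 0 by rewrite !dotE xx yy xy yx; ring.
have ux : '[u, x] = rc p by rewrite !dotE xx yx; ring.
have uy : '[u, y] = rc p by rewrite !dotE yy xy; ring.
have rp0 : rc p != 0 by rewrite rc_eq0.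
have u0 : u != 0 by apply: contra_neq rp0 => u0; rewrite -ux u0 dot0l.
have Tuv := ray_orth hdim hsurj hphi hT uv.
have Txy := ray_orth hdim hsurj hphi hT xy.
have Tux : '[T u, T x] != 0.
  apply: contra_neq rp0 => h; rewrite -ux.
  exact: (ray_orthV hdim hsurj hphi hT u0 x0).
have Tuy : '[T u, T y] != 0.
  apply: contra_neq rp0 => h; rewrite -uy.
  exact: (ray_orthV hdim hsurj hphi hT u0 y0).
have uu : '[u, u] = 1.
  by rewrite !dotE xx yy xy yx !mulr0 addr0 add0r !mulr1 -!rcM -rcD
    -!expr2 pp1.
have e1 := congr1 (fun A : S => '[A (T u), T x]) e.
have e2 := congr1 (fun A : S => '[A (T u), T y]) e.
have Tuu : '[T u, T u] = 1 by rewrite (ray_dot hT).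
have Txx : '[T x, T x] = 1 by rewrite (ray_dot hT).
have Tyy : '[T y, T y] = 1 by rewrite (ray_dot hT).
move: e1 e2; rewrite !bsaE !dotE Tuv (dot_eq0C Txy) Txy Tuu Txx Tyy.
rewrite !(mulr0, mul0r, addr0, add0r, mulr1, mul1r) => e1 e2.
apply: (@rc_inj R); apply: (mulIf Tux); rewrite -e1; congr (_ * _).
by apply: (mulIf Tuy); rewrite e2.
Qed.

Lemma coef_unit x y s : '[x, x] = 1 -> '[y, y] = 1 -> f x s = f y s.
Proof.
move=> xx yy; have [z' [z'0 xz yz]] := third_vector hdim x y.
have [r [z [r0 zz zE _]]] := unit_vector z'0.
have rr : rc r != 0 by rewrite rc_eq0 gt_eqF.
have xz' : '[x, z] = 0.
  by move/eqP: xz; rewrite zE dotE conj_rc mulf_eq0 (negPf rr) => /eqP.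
have yz' : '[y, z] = 0.
  by move/eqP: yz; rewrite zE dotE conj_rc mulf_eq0 (negPf rr) => /eqP.
by rewrite (coef_orth s xx zz xz') (coef_orth s yy zz yz').
Qed.

(* t P_x = (t/2) P_(x+y) + (t/2) P_(x-y) - t P_y avoids the direction x. *)
Lemma translation_self x t : '[x, x] = 1 -> translation (t *: P x) x.
Proof.
move=> xx; have x0 := unit_neq0 xx.
have [y' [y'0 xy' _]] := third_vector hdim x x.
have [r [y [r0 yy yE _]]] := unit_vector y'0.
have xy : '[x, y] = 0.
  move/eqP: xy'; rewrite yE dotE conj_rc mulf_eq0 rc_eq0 gt_eqF//.
  by move=> /eqP.
have yx := dot_eq0C xy; have y0 := unit_neq0 yy.
have npar a : a != 0 -> ~ parallel x (x + a *: y) /\ x + a *: y != 0.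
  move=> a0; split.
    case=> c e; have := congr1 (fun w => '[w, y]) e.
    rewrite !dotE xy yy add0r mulr1 mulr0 => /eqP; exact/negP.
  apply: contra_neq a0 => e; have := congr1 (fun w => '[w, y]) e.
  by rewrite !dotE xy yy add0r mulr1.
have [n1 u0] := npar 1 (oner_neq0 _).
have [n2 v0] : ~ parallel x (x + (-1) *: y) /\ x + (-1) *: y != 0.
  by apply: npar; rewrite oppr_eq0 oner_neq0.
have n3 : ~ parallel x y by exact: orth_not_parallel.
have := translation_step (- t) x0 y0 n3 (translation_step (t / 2) x0 v0 n2
  (translation_step (t / 2) x0 u0 n1 (translation0 x0))).
congr translation; apply: bsa_ext => v w; rewrite !(bsaE, dotE) !rcE.
by field.
Qed.

Lemma coef_linear : exists2 c : R, c != 0 &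
  forall u s, '[u, u] = 1 -> f u s = c * s.
Proof.
have [e [ee [d [dd ed]]]] : exists e : H, '[e, e] = 1 /\
    exists d : H, '[d, d] = 1 /\ '[e, d] = 0.
  have [x [x0 _ _]] := third_vector hdim 0 0.
  have [r [e [_ ee _ _]]] := unit_vector x0; exists e; split=> //.
  have [d' [d'0 ed' _]] := third_vector hdim e e.
  have [t [d [t0 dd dE _]]] := unit_vector d'0; exists d; split=> //.
  move/eqP: ed'; rewrite dE dotE conj_rc mulf_eq0 rc_eq0 gt_eqF//.
  by move=> /eqP.
have e0 := unit_neq0 ee.
pose F := f e.
have FE u s : '[u, u] = 1 -> f u s = F s by move=> uu; exact: coef_unit.
have FD s t : F (s + t) = F s + F t.
  apply/eqP; rewrite -subr_eq0; apply/eqP.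
  apply: (proj_scalar hdim (T_neq0 e0)).
  have := is_scalarB (is_scalarD (translation_self t ee s) (hf t e0)) (hf (s +
    t) e0).
  rewrite -scalerDl (addrC t s).
  congr is_scalar; apply: bsa_ext => v w; rewrite !(bsaE, dotE) !rcE -/F.
  by ring.
have F1 : F 1 != 0.
  apply/eqP => F1; have := hf 1 e0; rewrite -/F F1 scale0r subr0.
  move/(phi_scalar hsurj hphi _).2/(proj_scalar hdim e0)/eqP.
  by rewrite oner_eq0.
have Tee : '[T e, T e] = 1 by rewrite (ray_dot hT).
have Tde : '[T d, T e] = 0.
  by apply: (ray_orth hdim hsurj hphi hT); exact: dot_eq0C.
(* Pairing [sum_rel] with [T e] shows that [F (q s)] is [F s] times a sum of two squared moduli. The
   choice [2 a^2 = q] restricts [q] to values below 2, which is enough since [t < 2 s] or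
   [s < 2 t]. *)
have Fpos s q : 0 < q -> q < 2 -> 0 <= F s * F (q * s).
  move=> q0 q2; pose a := Num.sqrt (q / 2); pose b := Num.sqrt (1 - q / 2).
  have a0 : 0 < q / 2 by lra.
  have b0 : 0 < 1 - q / 2 by lra.
  have a1 : a != 0 by rewrite gt_eqF// sqrtr_gt0.
  have b1 : b != 0 by rewrite gt_eqF// sqrtr_gt0.
  have aa : a ^+ 2 = q / 2 by rewrite sqr_sqrtr// ltW.
  have bb : b ^+ 2 = 1 - q / 2 by rewrite sqr_sqrtr// ltW.
  have ab : a ^+ 2 + b ^+ 2 = 1 by rewrite aa bb addrC subrK.
  pose u := rc a *: e + rc b *: d; pose v := rc a *: e - rc b *: d.
  have uu : '[u, u] = 1.
    rewrite !dotE ee dd ed (dot_eq0C ed) !mulr0 addr0 add0r !mulr1 -!rcM -rcD.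
    by rewrite -!expr2 aa bb addrC subrK.
  have vv : '[v, v] = 1.
    rewrite !dotE ee dd ed (dot_eq0C ed) !mulr0 oppr0 addr0 add0r mulrN opprK.
    by rewrite !mulr1 -!rcM -rcD -!expr2 aa bb addrC subrK.
  have := sum_rel s ee dd ed a1 b1 ab (erefl u) (erefl v); rewrite aa.
  rewrite !FE// mulrCA mulfV ?pnatr_eq0// mulr1 => E.
  have := congr1 (fun A : S => '[A (T e), T e]) E.
  rewrite !bsaE !dotE (dot_eq0C Tde) Tee !(mul0r, mulr0, addr0, mulr1).
  move=> E'; rewrite -ler_rc rcM -E' rc0.
  have -> : rc (F s) * (rc (F s) * ('[T e, T u] * '[T u, T e]) +
     rc (F s) * ('[T e, T v] * '[T v, T e])) = rc (F s) ^+ 2 *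
     ('[T e, T u] * '[T e, T u]^* + '[T e, T v] * '[T e, T v]^*).
    by rewrite -!dotC; ring.
  rewrite -!normCK; apply: mulr_ge0; last by rewrite addr_ge0 ?exprn_ge0.
  by rewrite expr2 -rcM -rc0 ler_rc -expr2 sqr_ge0.
have Fpp s t : 0 < s -> 0 < t -> 0 <= F s * F t.
  move=> s0 t0; have [ts|ts] := ltP t (2 * s).
    have -> : t = t / s * s by rewrite divfK ?gt_eqF.
    by apply: Fpos; rewrite ?divr_gt0// ltr_pdivrMr.
  rewrite mulrC; have -> : s = s / t * t by rewrite divfK ?gt_eqF.
  by apply: Fpos; rewrite ?divr_gt0// ltr_pdivrMr//; lra.
exists (F 1) => // u s uu; rewrite FE//.
exact: additive_pos_linear.
Qed.
End Functions.

Lemma proj0 : P 0 = 0.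
Proof. by apply: bsaP => v; rewrite !bsaE scaler0. Qed.

Lemma ray0 : T 0 = 0.
Proof. by apply/eqP; rewrite -dot_eq0 (ray_dot hT) dot0l. Qed.

(** Although [T] itself need not be homogeneous, [P (T x)] depends only on the ray and the norm, and
    [T] preserves parallelism and norms. *)
Lemma ray_projZ x y r : x != 0 -> y != 0 -> parallel x y -> P y = r *: P x ->
  P (T y) = r *: P (T x).
Proof.
move=> x0 y0 xy e; have [s s0 xx] := dot_real x0; have [t t0 yy] := dot_real y0.
have e1 : s *: P (T y) = t *: P (T x).
  apply: proj_parallel; rewrite ?T_neq0 ?(ray_dot hT)//.
  exact: (ray_parallel hdim hsurj hphi hT x0 y0).1.
have e2 : s *: P y = t *: P x by exact: proj_parallel.
have tE : t = s * r.
  move: e2; rewrite e scalerA => /eqP;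
    rewrite eq_sym -subr_eq0 -scalerBl => /eqP h.
  apply/eqP; rewrite -subr_eq0; apply/eqP/(proj_scalar hdim x0).
  by rewrite h; exists 0; rewrite scale0r.
apply: (scalerI (a := s)); first by rewrite gt_eqF.
by rewrite e1 tE scalerA.
Qed.

Lemma phi_rank_two : exists2 c : R, c != 0 & forall x y s t,
  is_scalar (phi (s *: P x + t *: P y) -
             ((c * s) *: P (T x) + (c * t) *: P (T y))).
Proof.
have [f hf] := coef_exists; have [c c0 fc] := coef_linear hf.
have fE x s : x != 0 -> f x s = c * s.
  move=> x0; have [r [u [r0 uu xE xx]]] := unit_vector x0.
  have u0 := unit_neq0 uu.
  have Px : P x = r ^+ 2 *: P u.
    by apply: bsa_ext => v w; rewrite xE !(bsaE, dotE) expr2 !rcE; ring.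
  have PTx : P (T x) = r ^+ 2 *: P (T u).
    by apply: ray_projZ => //; exists (rc r).
  have e : (f x s - c * s) * r ^+ 2 = 0.
    apply: (proj_scalar hdim (T_neq0 u0)).
    apply: (is_scalar_ext (is_scalarB (hf u (s * r ^+ 2) u0) (hf x s x0))).
    by move=> v w; rewrite Px PTx fc// scalerA !(bsaE, dotE) !rcE; ring.
  move/eqP: e; rewrite mulf_eq0 expf_eq0 /= (gt_eqF r0) orbF subr_eq0.
  by move=> /eqP.
exists c => // x y s t.
have [->|x0] := eqVneq x 0; have [->|y0] := eqVneq y 0.
- by rewrite ray0 proj0 !scaler0 addr0 subr0.
- by rewrite ray0 proj0 !scaler0 !add0r -(fE y t y0); exact: hf.
- by rewrite ray0 proj0 !scaler0 !addr0 -(fE x s x0); exact: hf.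
have [xy|xy] := pselect (parallel x y); last first.
  have h := translation_step t x0 y0 xy (translation0 hf x0) s.
  rewrite add0r (addrC (t *: _)) in h.
  apply: (is_scalar_ext (is_scalarD h (hf y t y0))) => v w; rewrite !fE//.
  by rewrite !(bsaE, dotE) !rcE; ring.
have [p p0 xx] := dot_real x0; have [q q0 yy] := dot_real y0.
have e : P y = (q / p) *: P x.
  apply: (scalerI (a := p)); first by rewrite gt_eqF.
  by rewrite scalerA mulrCA mulfV ?gt_eqF// mulr1; exact: proj_parallel.
rewrite (ray_projZ x0 y0 xy e) e !scalerA -!scalerDl -mulrA -mulrDr -(fE x _
  x0).
exact: hf.
Qed.

End Coefficients.

(** * Wigner's theorem, after Bargmann *)

Section Wigner.
Variables (R : realType) (H : hilbertType R).
Local Notation "''[' x , y ]" := (dot x y) : ring_scope.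
Implicit Types (x y z u v w : H) (a b : Cx R).
Variable T : H -> H.
Hypothesis hT : forall x y, '[T x, T y] * '[T y, T x] = '[x, y] * '[y, x].
Hypothesis Tsurj : forall y, y != 0 -> exists2 x, x != 0 & parallel (T x) y.

Lemma ray_norm x : '[T x, T x] = '[x, x].
Proof.
by have /eqP := hT x x; rewrite -!expr2 eqrXn2// ?dot_ge0// => /eqP.
Qed.

Lemma ray_nz x : x != 0 -> T x != 0.
Proof. by rewrite -!dot_eq0 ray_norm. Qed.

(** Preserved transition probabilities preserve equality in Cauchy-Schwarz. *)
Lemma ray_par a x : T (a *: x) = 0 \/ parallel (T (a *: x)) (T x).
Proof.
have [h|h] := eqVneq (T (a *: x)) 0; [by left|right].
exists ('[T x, T (a *: x)] / '[T (a *: x), T (a *: x)]).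
by apply: cauchy_schwarz_eq => //; rewrite hT !ray_norm !dotE; ring.
Qed.

Variable e : H.
Hypothesis ee : '[e, e] = 1.

Let e' := T e.

Let ee' : '[e', e'] = 1. Proof. by rewrite ray_norm. Qed.

(* T (e + x), rescaled to have component e' along e'; the remaining part depends
   real-linearly on x orthogonal to e. *)
Definition bargmann x : H := locked ('[T (e + x), e']^-1 *: T (e + x) - e').
Local Notation V := bargmann.

Lemma bargmann_coef x : '[x, e] = 0 -> '[T (e + x), e'] * '[T (e + x), e']^* =
  1.
Proof. by move=> xe; rewrite -dotC hT !dotE ee xe (dot_eq0C xe) !addr0 mulr1.
  Qed.

Lemma bargmann_coef_neq0 x : '[x, e] = 0 -> '[T (e + x), e'] != 0.
Proof.
by move=> /bargmann_coef h; apply/eqP => h0; move/eqP: h;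
  rewrite h0 mul0r eq_sym oner_eq0.
Qed.

Lemma bargmann_par x : e' + V x = '[T (e + x), e']^-1 *: T (e + x).
Proof. by rewrite /bargmann -lock addrC subrK. Qed.

Lemma bargmann_orth x : '[x, e] = 0 -> '[V x, e'] = 0.
Proof.
by move=> xe; rewrite /bargmann -lock !dotE ee' mulVf ?bargmann_coef_neq0//
  subrr.
Qed.

(** This is the transition probability between [e + x] and [e + y]; the rescaling factors have
    modulus one and cancel. *)
Lemma bargmann_prod x y : '[x, e] = 0 -> '[y, e] = 0 ->
  (1 + '[V x, V y]) * (1 + '[V y, V x]) =
  (1 + '[x, y]) * (1 + '[y, x]).
Proof.
move=> xe ye.
have h u v : '[u, e'] = 0 -> '[v, e'] = 0 -> '[e' + u, e' + v] = 1 + '[u, v].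
  by move=> ue ve; rewrite !dotE ee' ue (dot_eq0C ve) addr0 add0r.
have ox := bargmann_orth xe; have oy := bargmann_orth ye.
rewrite -(h _ _ ox oy) -(h _ _ oy ox) !bargmann_par//.
have := hT (e + x) (e + y).
rewrite !dotE ee xe ye (dot_eq0C xe) (dot_eq0C ye) !addr0 !add0r => <-.
have cx := bargmann_coef xe; have cy := bargmann_coef ye.
have x0 := bargmann_coef_neq0 xe; have y0 := bargmann_coef_neq0 ye.
have -> : '[T (e + x), e']^* = '[T (e + x), e']^-1.
  by apply: (mulfI x0); rewrite cx mulfV.
have -> : '[T (e + y), e']^* = '[T (e + y), e']^-1.
  by apply: (mulfI y0); rewrite cy mulfV.
by field; rewrite x0 y0.
Qed.

Lemma bargmann_norm x : '[x, e] = 0 -> '[V x, V x] = '[x, x].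
Proof.
move=> xe; have /eqP := bargmann_prod xe xe; rewrite -!expr2 eqrXn2//.
- by move=> /eqP/addrI.
- by rewrite addr_ge0 ?dot_ge0.
- by rewrite addr_ge0 ?dot_ge0.
Qed.

(** The transition probability between [e + x] and [x] gives equality in Cauchy-Schwarz for [V x]
    and [T x], because [T x] is orthogonal to [e']. *)
Lemma bargmann_ray x : '[x, e] = 0 -> x != 0 ->
  exists a, a * a^* = 1 /\ V x = a *: T x.
Proof.
move=> xe x0; have Tx0 := ray_nz x0.
have xe' : '[T x, e'] = 0.
  apply/eqP; have /eqP := hT x e; rewrite xe mul0r mulf_eq0 => /orP[//|/eqP h].
  by rewrite (dot_eq0C h).
have h : '[V x, T x] * '[T x, V x] = '[x, x] * '[x, x].
  have := hT (e + x) x; rewrite !dotE xe (dot_eq0C xe) !add0r => <-.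
  have -> : T (e + x) = '[T (e + x), e'] *: (e' + V x).
    by rewrite bargmann_par// cscalerA mulfV ?cscale1r// bargmann_coef_neq0.
  by rewrite !dotE xe' (dot_eq0C xe') !add0r mulrACA bargmann_coef// mul1r.
exists ('[V x, T x] / '[T x, T x]); split; last first.
  by apply: cauchy_schwarz_eq => //; rewrite h bargmann_norm// ray_norm.
rewrite !dotE dot_conj mulrACA -(dotC (T x)) h ray_norm.
by field; rewrite dot_eq0.
Qed.

Lemma bargmann0 : V 0 = 0.
Proof. by apply/eqP; rewrite -dot_eq0 bargmann_norm dot0l. Qed.

Lemma bargmann_abs x y : '[x, e] = 0 -> '[y, e] = 0 ->
  '[V x, V y] * '[V y, V x] = '[x, y] * '[y, x].
Proof.
move=> xe ye.
have [->|x0] := eqVneq x 0; first by rewrite bargmann0 !dot0l !mul0r.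
have [->|y0] := eqVneq y 0; first by rewrite bargmann0 !dot0l !mulr0.
have [a [aa ->]] := bargmann_ray xe x0; have [b [bb ->]] := bargmann_ray ye y0.
rewrite -(hT x y) !dotE.
transitivity ((a * a^*) * (b * b^*) * ('[T x, T y] * '[T y, T x]));
  first by ring.
by rewrite aa bb !mul1r.
Qed.

(** Twice the real part of [z] is [|1 + z|^2 - 1 - |z|^2], and both moduli are preserved. *)
Lemma bargmann_re x y : '[x, e] = 0 -> '[y, e] = 0 ->
  '[V x, V y] + '[V y, V x] = '[x, y] + '[y, x].
Proof.
move=> xe ye; have h := bargmann_prod xe ye; have k := bargmann_abs xe ye.
transitivity ((1 + '[V x, V y]) * (1 + '[V y, V x]) - 1 -
  '[V x, V y] * '[V y, V x]); first by ring.
by rewrite h k; ring.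
Qed.

Let perpD x y : '[x, e] = 0 -> '[y, e] = 0 -> '[x + y, e] = 0.
Proof. by move=> h k; rewrite dotE h k addr0. Qed.
Let perpZ a x : '[x, e] = 0 -> '[a *: x, e] = 0.
Proof. by move=> h; rewrite dotE h mulr0. Qed.

(** The squared norm of the difference involves only norms and real parts of inner products, all
    preserved by [V], so it vanishes as it does for the original vectors. *)
Lemma bargmannD x y : '[x, e] = 0 -> '[y, e] = 0 -> V (x + y) = V x + V y.
Proof.
move=> xe ye; have me := perpD xe ye.
apply/eqP; rewrite -subr_eq0 -dot_eq0; apply/eqP.
transitivity ('[V (x + y), V (x + y)] + '[V x, V x] + '[V y, V y]
  - ('[V (x + y), V x] + '[V x, V (x + y)])
  - ('[V (x + y), V y] + '[V y, V (x + y)])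
  + ('[V x, V y] + '[V y, V x])).
  by rewrite !dotE; ring.
by rewrite !bargmann_re// !bargmann_norm// !dotE; ring.
Qed.

Lemma bargmannZr (r : R) x : '[x, e] = 0 -> V (rc r *: x) = rc r *: V x.
Proof.
move=> xe; have re := perpZ (rc r) xe.
apply/eqP; rewrite -subr_eq0 -dot_eq0; apply/eqP.
transitivity ('[V (rc r *: x), V (rc r *: x)] +
  rc r * rc r * '[V x, V x]
  - rc r * ('[V (rc r *: x), V x] + '[V x, V (rc r *: x)])).
  by rewrite !dotE; ring.
by rewrite !bargmann_re// !bargmann_norm// !dotE; ring.
Qed.

(** The inner product of [V (i x)] with [V x] is purely imaginary and of maximal modulus, so
    equality holds in Cauchy-Schwarz with factor [i] or [-i]. *)
Lemma bargmann_i x : '[x, e] = 0 ->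
  V ('i *: x) = 'i *: V x \/ V ('i *: x) = (- 'i) *: V x.
Proof.
move=> xe; have ie := perpZ 'i xe.
have [->|x0] := eqVneq x 0; first by left; rewrite scaler0 bargmann0 scaler0.
have n0 : '[x, x] != 0 by rewrite dot_eq0.
have w0 : V x != 0 by rewrite -dot_eq0 bargmann_norm.
have ii : ('i : Cx R) * 'i = -1 by rewrite -expr2 sqrCi.
have re := bargmann_re ie xe; have ab := bargmann_abs ie xe.
rewrite !dotE conjCi in re ab.
have {}re : '[V x, V ('i *: x)] = - '[V ('i *: x), V x].
  by apply/eqP; rewrite -addr_eq0 addrC re mulNr subrr.
have ab' : '[V ('i *: x), V x] ^+ 2 = ('i * '[x, x]) ^+ 2.
  apply: oppr_inj; rewrite expr2 -mulrN -re ab !expr2; ring.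
have wi : V ('i *: x) =
    ('[V ('i *: x), V x] / '[V x, V x]) *: V x.
  apply: cauchy_schwarz_eq => //; rewrite ab !bargmann_norm// !dotE conjCi;
    ring.
rewrite wi bargmann_norm//.
move/eqP: ab'; rewrite eqf_sqr => /orP[] /eqP ->; [left|right].
  by rewrite mulfK.
by rewrite -mulNr mulfK.
Qed.

(* Mixed behaviour at x and y would contradict additivity at x + y. *)
Lemma bargmann_dichotomy :
  (forall x, '[x, e] = 0 -> V ('i *: x) = 'i *: V x) \/
  (forall x, '[x, e] = 0 -> V ('i *: x) = (- 'i) *: V x).
Proof.
apply: contrapT => /not_orP[/existsNP[x /not_implyP[xe nx]]
  /existsNP[y /not_implyP[ye ny]]].
have hx : V ('i *: x) = (- 'i) *: V x by case: (bargmann_i xe).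
have hy : V ('i *: y) = 'i *: V y by case: (bargmann_i ye).
have i0 : ('i : Cx R) != 0 by rewrite neq0Ci.
have z0 u : 'i *: u = (- 'i) *: u -> u = 0.
  move=> /eqP; rewrite cscaleNr -addr_eq0 -mulr2n -scaler_nat !scaler_eq0.
  by rewrite pnatr_eq0 (negPf i0) => /eqP.
case: (bargmann_i (perpD xe ye));
  rewrite scalerDr !bargmannD ?perpZ// hx hy scalerDr.
  by move/addIr/esym/z0 => w0; apply: nx; rewrite hx w0 !scaler0.
by move/addrI/z0 => w0; apply: ny; rewrite hy w0 !scaler0.
Qed.

(** Real linearity and the uniform action on [i] give semilinearity. Inner products follow from the
    preserved real parts at [x] and at [i x]. One morphism [sigma] covers both cases. *)
Lemma bargmann_linear : exists sigma : {rmorphism Cx R -> Cx R},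
  [/\ involutive sigma, forall a, sigma a^* = (sigma a)^*,
      (sigma =1 id) \/ (sigma =1 Num.conj),
      forall a x, '[x, e] = 0 -> V (a *: x) = sigma a *: V x &
      forall x y, '[x, e] = 0 -> '[y, e] = 0 ->
        '[V x, V y] = sigma '[x, y]].
Proof.
have ii : ('i : Cx R) * 'i = -1 by rewrite -expr2 sqrCi.
have i0 : ('i : Cx R) != 0 by rewrite neq0Ci.
have rect a : exists p q : R, a = rc p + rc q * 'i.
  have [p hp] : exists p, 'Re a = rc p.
    by apply: conj_eq_rc; apply/CrealP; exact: Creal_Re.
  have [q hq] : exists p, 'Im a = rc p.
    by apply: conj_eq_rc; apply/CrealP; exact: Creal_Im.
  by exists p, q; rewrite {1}[a]Crect hp hq mulrC.
have two (c d c' d' : Cx R) : c + d = c' + d' -> c - d = c' - d' -> c = c'.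
  move=> h1 h2; have h : c *+ 2 = c' *+ 2.
    transitivity ((c + d) + (c - d)); first by ring.
    by rewrite h1 h2; ring.
  by move/eqP: h; rewrite eqrMn2r => /eqP.
case: bargmann_dichotomy => hi; [exists idfun|exists Num.conj]; split=> //=.
- by left.
- move=> a x xe; have [p [q ->]] := rect a.
  rewrite !cscalerDl bargmannD ?perpZ// -cscalerA !bargmannZr ?perpZ// hi//.
  by rewrite cscalerA.
- move=> x y xe ye; apply: (two _ '[V y, V x] _ '[y, x]).
    exact: bargmann_re.
  have := bargmann_re (perpZ 'i xe) ye; rewrite hi// !dotE conjCi !mulNr.
  by rewrite -!mulrBr => /(mulfI i0).
- by move=> a; rewrite conjCK.
- by right.
- move=> a x xe; have [p [q ->]] := rect a.
  rewrite conjD conjM !conj_rc conjCi.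
  rewrite !cscalerDl bargmannD ?perpZ// -cscalerA !bargmannZr ?perpZ// hi//.
  by rewrite cscalerA.
- move=> x y xe ye; rewrite -dotC; apply: (two _ '[V y, V x] _ '[x, y]).
    by rewrite bargmann_re// addrC.
  have := bargmann_re (perpZ 'i xe) ye; rewrite hi// !dotE conjCi !mulNr.
  rewrite opprK addrC -!mulrBr => /(mulfI i0) h.
  by rewrite -opprB h opprB.
Qed.

Theorem wigner : exists (U : H -> H) (sigma : {rmorphism Cx R -> Cx R}),
  [/\ (sigma =1 id) \/ (sigma =1 Num.conj),
      forall a x y, U (a *: x + y) = sigma a *: U x + U y,
      forall x y, '[U x, U y] = sigma '[x, y],
      bijective U & forall x, exists a, U x = a *: T x].
Proof.
have [sigma [invol sconj scases VZ Vdot]] := bargmann_linear.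
pose pr x := x - '[x, e] *: e.
have pe x : '[pr x, e] = 0 by rewrite /pr !dotE ee mulr1 subrr.
pose U x := sigma '[x, e] *: e' + V (pr x).
exists U, sigma.
have Ulin a x y : U (a *: x + y) = sigma a *: U x + U y.
  rewrite /U; have -> : pr (a *: x + y) = a *: pr x + pr y.
    by apply: dot_inj => z; rewrite /pr !dotE; ring.
  rewrite bargmannD ?perpZ// VZ// !dotE rmorphD rmorphM cscalerDl scalerDr
    cscalerA.
  by rewrite addrACA.
have Udot x y : '[U x, U y] = sigma '[x, y].
  rewrite /U !dotE ee' (dot_eq0C (bargmann_orth (pe y))) (bargmann_orth (pe x))
    Vdot//.
  rewrite !mulr0 addr0 add0r mulr1 -sconj -rmorphM -rmorphD; congr (sigma _).
  rewrite /pr !dotE ee -(dotC e y); ring.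
have s0 a : (sigma a == 0) = (a == 0) by rewrite fmorph_eq0.
have U0 x : x != 0 -> U x != 0 by rewrite -!dot_eq0 Udot s0.
have UT x : exists a, U x = a *: T x.
  have [->|x0] := eqVneq x 0.
    by exists 0; apply/eqP; rewrite cscale0r -dot_eq0 Udot dot0l rmorph0.
  have [xe|xe] := eqVneq '[x, e] 0.
    have prx : pr x = x by rewrite /pr xe cscale0r subr0.
    rewrite /U xe rmorph0 cscale0r add0r prx.
    by have [a [_ h]] := bargmann_ray xe x0; exists a.
  (* Here [x] is a multiple of [e + k], so [U x] is a multiple of [e' + V k], which lies on the ray
     of [T (e + k)] and hence on that of [T x]. *)
  pose k := '[x, e]^-1 *: pr x.
  have ke : '[k, e] = 0 by exact: perpZ.
  have prE : pr x = '[x, e] *: k by rewrite /k cscalerA mulfV// cscale1r.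
  have xE : x = '[x, e] *: (e + k).
    by rewrite scalerDr -prE /pr addrC subrK.
  have [h|[a h]] := ray_par '[x, e] (e + k).
    by move/eqP: (ray_nz x0); rewrite {1}xE.
  rewrite -xE in h.
  exists (sigma '[x, e] * ('[T (e + k), e']^-1 * a)).
  rewrite /U prE VZ// -scalerDr bargmann_par//.
  by rewrite -!cscalerA -h.
split=> //.
have U00 : U 0 = 0 by apply/eqP; rewrite -dot_eq0 Udot dot0l rmorph0.
have UZ a x : U (a *: x) = sigma a *: U x.
  by rewrite -[a *: x]addr0 Ulin U00 addr0.
have Uinj : injective U.
  move=> x y h; apply/eqP; rewrite -subr_eq0; apply/negPn/negP => /U0.
  have -> : x - y = (-1) *: y + x by rewrite scaleN1r addrC.
  by rewrite Ulin h rmorphN1 scaleN1r addNr eqxx.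
have /choice[g hg] : forall y, exists x, U x = y.
  move=> y; have [->|y0] := eqVneq y 0.
    by exists 0.
  have [x x0 [a ya]] := Tsurj y0; have [c Ux] := UT x.
  have c0 : c != 0.
    by apply: contra_neq (U0 _ x0) => c0; rewrite Ux c0 cscale0r.
  exists (sigma (a / c) *: x); rewrite UZ invol Ux cscalerA divfK//.
by exists g => x //; apply: Uinj; rewrite hg.
Qed.

End Wigner.

(** * Preservation of transition probabilities *)

Section Transition.
Variables (R : realType) (H : hilbertType R).
Hypothesis hdim : dim_ge H 3.
Local Notation S := (bounded_self_adjoint H).
Local Notation "''[' x , y ]" := (dot x y) : ring_scope.
Local Notation I := (bsa_one H).
Local Notation P := (@bsa_proj R H).
Implicit Types (A B C D E G : S) (x y z u v w : H) (a b : Cx R) (r s t : R).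
Variable phi : S -> S.
Hypothesis hsurj : forall Y, exists X, phi X = Y.
Hypothesis hphi : forall A B C,
  quasicomm (A - B) C <-> quasicomm (phi A - phi B) (phi C).
Variable T : H -> H.
Hypothesis hT : represents phi T.

Let q x y : Cx R := '[x, y] * '[y, x].

Let qE x y : q x y = '[P y x, x].
Proof. by rewrite bsaE dotE. Qed.

Let qC x y : q x y = q y x. Proof. by rewrite /q mulrC. Qed.

Let q_parallel x y : x != 0 -> y != 0 -> parallel x y -> q (T x) (T y) = q x y.
Proof.
move=> x0 y0 xy; have [s s0 xx] := dot_real x0; have [t t0 yy] := dot_real y0.
have e : P y = (t / s) *: P x.
  apply: (scalerI (a := s)); first by rewrite gt_eqF.
  by rewrite scalerA mulrCA mulfV ?gt_eqF// mulr1; exact: proj_parallel.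
rewrite !qE (ray_projZ hdim hsurj hphi hT x0 y0 xy e) e.
by rewrite !bsaE !dotE !(ray_dot hT).
Qed.

Let q_scale x y z r : x != 0 -> y = rc r *: x -> r != 0 ->
  q (T z) (T y) = rc (r ^+ 2) * q (T z) (T x).
Proof.
move=> x0 yE r0; have y0 : y != 0 by rewrite yE cscaler_eq0 rc_eq0 negb_or r0.
rewrite !qE (@ray_projZ _ _ hdim _ hsurj hphi _ hT x y (r ^+ 2)) ?bsaE ?dotE//.
  by exists (rc r).
by apply: bsa_ext => v w; rewrite yE !(bsaE, dotE) expr2 !rcE; ring.
Qed.

(* Pair P_(T(x+y)) + P_(T(x-y)) = 2 P_(Tx) + 2 P_(Ty) with each of the four
   vectors; x + y and x - y are orthogonal since <x, y> is real. *)
Let q_real x y : '[x, x] = 1 -> '[y, y] = 1 -> '[x, y] = '[y, x] ->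
  q (T x) (T y) = q x y.
Proof.
move=> xx yy xy; have x0 := unit_neq0 xx; have y0 := unit_neq0 yy.
have [par|npar] := pselect (parallel x y); first exact: q_parallel.
have [c c0 hc] := phi_rank_two hdim hsurj hphi hT.
have [z [z0 xz yz]] := third_vector hdim x y.
pose u := x + y; pose v := x - y.
have Puv : 1 *: P u + 1 *: P v = 2 *: P x + 2 *: P y.
  by apply: bsa_ext => w w'; rewrite !(bsaE, dotE) !rcE; ring.
have T_orth w : '[w, z] = 0 -> '[T z, T w] = 0.
  by move=> wz; apply: (ray_orth hdim hsurj hphi hT); exact: dot_eq0C.
have uz : '[u, z] = 0 by rewrite !dotE xz yz addr0.
have vz : '[v, z] = 0 by rewrite !dotE xz yz subr0.
have uv : '[u, v] = 0 by rewrite !dotE xx yy xy; ring.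
have Tuv : q (T u) (T v) = 0.
  by rewrite /q (ray_orth hdim hsurj hphi hT uv) mul0r.
have e : (P (T u) + P (T v)) - 2 *: (P (T x) + P (T y)) = 0.
  apply: (lift_eq (T := T) (z := z)); first exact: (ray_neq0 hT).
    rewrite !bsaE (T_orth _ xz) (T_orth _ yz) (T_orth _ uz) (T_orth _ vz).
    by rewrite !cscale0r !addr0 scaler0 subr0.
  have h := hc u v 1 1; rewrite Puv in h.
  apply: (is_scalar_ext (is_scalarZ c^-1 (is_scalarB (hc x y 2 2) h))).
  move=> w w'; rewrite !(bsaE, dotE) !rcE; field; by rewrite fmorph_eq0.
have pair w : q w (T u) + q w (T v) = 2 * (q w (T x) + q w (T y)).
  have := congr1 (fun A : S => '[A w, w]) e.
  rewrite !(bsaE, dotE) => h; apply/eqP; rewrite -subr_eq0 -[X in _ == X]h.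
  by apply/eqP; rewrite /q !rcE; ring.
have Tq w : q (T w) (T w) = '[w, w] * '[w, w] by rewrite /q !(ray_dot hT).
have e1 := pair (T u); have e2 := pair (T v).
have e3 := pair (T x); have e4 := pair (T y).
rewrite Tuv addr0 Tq in e1; rewrite (qC (T v)) Tuv add0r Tq in e2.
rewrite Tq xx mulr1 in e3; rewrite Tq yy mulr1 (qC (T y) (T x)) in e4.
rewrite !(qC (T u)) in e1; rewrite !(qC (T v)) in e2.
(* Adding the pairings at [T u] and [T v] and substituting those at [T x] and [T y] leaves
   [q (T x) (T y)] as the only unknown. *)
have sum : '[u, u] * '[u, u] + '[v, v] * '[v, v] =
    2 * (2 * (1 + q (T x) (T y)) + 2 * (q (T x) (T y) + 1)).
  by rewrite e1 e2 -e3 -e4; ring.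
have sum' : '[u, u] * '[u, u] + '[v, v] * '[v, v] = 8 + 8 * q x y.
  by rewrite /q !dotE xx yy xy; ring.
rewrite sum' in sum.
have n8 : (8 : Cx R) != 0 by rewrite pnatr_eq0.
apply: (mulfI n8); apply: (addrI 8); rewrite sum; ring.
Qed.

(** Multiplying [y] by the phase [l] of ['[x, y]] makes the inner product real and changes neither
    [P y] nor [P (T y)]. *)
Let q_unit x y : '[x, x] = 1 -> '[y, y] = 1 -> q (T x) (T y) = q x y.
Proof.
move=> xx yy; have x0 := unit_neq0 xx; have y0 := unit_neq0 yy.
have [xy|xy] := eqVneq '[x, y] 0.
  by rewrite /q (ray_orth hdim hsurj hphi hT xy) xy !mul0r.
have k0 : `|'[x, y]| != 0 by rewrite normr_eq0.
have kk : '[x, y] * '[x, y]^* = `|'[x, y]| ^+ 2 by rewrite normCK.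
have kr : `|'[x, y]|^* = `|'[x, y]| by apply/CrealP; exact: normr_real.
pose l := '[x, y] / `|'[x, y]|; pose y' := l *: y.
have ll : l * l^* = 1.
  by rewrite /l conjM conjV kr mulrACA kk -invfM -expr2 mulfV// expf_neq0.
have l0 : l != 0 by rewrite mulf_neq0 ?invr_neq0.
have lE : l^* * '[x, y] = l * '[y, x].
  by rewrite /l conjM conjV kr -(dotC y x); ring.
clearbody l.
have y'y' : '[y', y'] = 1 by rewrite !dotE yy mulr1 ll.
have Py' : P y' = 1 *: P y.
  apply: bsa_ext => v w; rewrite !(bsaE, dotE) rcE.
  by transitivity ((l * l^*) * ('[v, y] * '[y, w])); [ring|rewrite ll].
have PTy' : P (T y') = 1 *: P (T y).
  apply: (ray_projZ hdim hsurj hphi hT) => //; last by exists l.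
  exact: unit_neq0.
have -> : q x y = q x y' by rewrite !qE Py' scale1r.
have -> : q (T x) (T y) = q (T x) (T y') by rewrite !qE PTy' scale1r.
by apply: q_real => //; rewrite !dotE lE.
Qed.

Lemma ray_transition x y : '[T x, T y] * '[T y, T x] = '[x, y] * '[y, x].
Proof.
rewrite -!/(q _ _).
have [->|x0] := eqVneq x 0; first by rewrite (ray0 hT) /q !dot0l !mul0r.
have [->|y0] := eqVneq y 0; first by rewrite (ray0 hT) /q !dot0l !mulr0.
have [r [u [r0 uu xE _]]] := unit_vector x0.
have [s [v [s0 vv yE _]]] := unit_vector y0.
rewrite (q_scale _ (unit_neq0 vv) yE) ?gt_eqF// qC.
rewrite (q_scale _ (unit_neq0 uu) xE) ?gt_eqF// q_unit// /q xE yE !dotE.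
by rewrite !expr2 !rcE; ring.
Qed.

End Transition.

(** * Comparison of phi with conjugation by a semilinear isometry *)

Section Representation.
Variables (R : realType) (H : hilbertType R).
Hypothesis hdim : dim_ge H 3.
Local Notation S := (bounded_self_adjoint H).
Local Notation "''[' x , y ]" := (dot x y) : ring_scope.
Local Notation I := (bsa_one H).
Local Notation P := (@bsa_proj R H).
Implicit Types (A B C D E G : S) (x y z u v w : H) (a b : Cx R) (r s t : R).

Section SemilinearIsometry.
Variables (U V : H -> H) (sigma : {rmorphism Cx R -> Cx R}).
Hypothesis sigma_cases : (sigma =1 id) \/ (sigma =1 Num.conj).
Hypothesis Ulin : forall a x y, U (a *: x + y) = sigma a *: U x + U y.
Hypothesis Udot : forall x y, '[U x, U y] = sigma '[x, y].
Hypotheses (UK : cancel U V) (VK : cancel V U).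

Lemma sigmaK : involutive sigma.
Proof. by case: sigma_cases => h a; rewrite !h ?conjCK. Qed.

Lemma sigma_rc r : sigma (rc r) = rc r.
Proof. by case: sigma_cases => h; rewrite h ?conj_rc. Qed.

Lemma isometry0 : U 0 = 0.
Proof. by apply/eqP; rewrite -dot_eq0 Udot dot0l rmorph0. Qed.

Lemma isometryZ a x : U (a *: x) = sigma a *: U x.
Proof. by rewrite -[a *: x]addr0 Ulin isometry0 addr0. Qed.

Lemma isometryD x y : U (x + y) = U x + U y.
Proof. by rewrite -[x]cscale1r Ulin rmorph1 !cscale1r. Qed.

Lemma isometryN x : U (- x) = - U x.
Proof. by rewrite -scaleN1r isometryZ rmorphN1 scaleN1r. Qed.

Lemma isometry_norm x : `|U x| = `|x| :> Cx R.
Proof.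
apply/eqP; rewrite -(@eqrXn2 _ 2)// !sqr_norm_dot Udot.
have [->|x0] := eqVneq x 0; first by rewrite dot0l rmorph0.
by have [r _ ->] := dot_real x0; rewrite sigma_rc.
Qed.

Lemma bsa_conj A : exists B : S, forall x, B (U x) = U (A x).
Proof.
have Vlin a x y : V (a *: x + y) = sigma a *: V x + V y.
  by rewrite -{1}(VK x) -{1}(VK y) -{1}(sigmaK a) -Ulin UK.
have [M M0 hM] := bsa_bound A.
have [|//|x|x y|B hB] := @bsa_exists R H (fun y => U (A (V y))) M.
- by move=> a x y; rewrite Vlin opD opZ Ulin sigmaK.
- by rewrite isometry_norm -{2}(VK x) isometry_norm.
- by rewrite -{1}(VK y) -{2}(VK x) !Udot bsa_dot.
by exists B => x; rewrite hB UK.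
Qed.

Lemma proj_isometry x y : P (U x) (U y) = U (P x y).
Proof. by rewrite !bsaE isometryZ Udot. Qed.

End SemilinearIsometry.

(** [P (x + w) - P w] sends [x] to ['[x, x] *: w] plus a multiple of [x], so [w] is chosen with
    ['[x, x] *: w = A x]. *)
Lemma eig_rank_two A x : x != 0 -> exists w, eig (A - (P (x + w) - P w)) x.
Proof.
move=> x0; have xx : '[x, x] != 0 by rewrite dot_eq0.
pose w := '[x, x]^-1 *: A x; exists w.
have Ax : A x = '[x, x] *: w by rewrite /w cscalerA mulfV// cscale1r.
clearbody w; exists (- ('[x, x] + '[x, w])).
apply: dot_inj => z; rewrite !(bsaE, dotE) Ax !dotE; ring.
Qed.

Variable phi : S -> S.
Hypothesis hsurj : forall Y, exists X, phi X = Y.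
Hypothesis hphi : forall A B C,
  quasicomm (A - B) C <-> quasicomm (phi A - phi B) (phi C).

Theorem phi_form : exists (c : R) (U V : H -> H)
    (sigma : {rmorphism Cx R -> Cx R}),
  [/\ c != 0, (sigma =1 id) \/ (sigma =1 Num.conj),
      (forall a x y, U (a *: x + y) = sigma a *: U x + U y) /\
      (forall x y, '[U x, U y] = sigma '[x, y]),
      cancel U V /\ cancel V U &
      forall A, exists r, forall x,
        phi A (U x) = rc c *: U (A x) + rc r *: U x].
Proof.
have [T hT] := ray_map_exists hdim hsurj hphi.
have [c c0 hc] := phi_rank_two hdim hsurj hphi hT.
have [e ee] : exists e : H, '[e, e] = 1.
  have [x [x0 _ _]] := third_vector hdim 0 0.
  by have [r [e [_ ee _ _]]] := unit_vector x0; exists e.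
have [U [sigma [hs Ulin Udot [V UK VK] UT]]] := wigner
  (ray_transition hdim hsurj hphi hT) (ray_surj hdim hsurj hphi hT) ee.
exists c, U, V, sigma; split=> // A.
(* [U x] and [T x] lie on one ray and have equal norms, so they differ by a phase. *)
have PU x : P (U x) = P (T x).
  have [a Ux] := UT x; have [->|x0] := eqVneq x 0.
    by rewrite (isometry0 Udot) (ray0 hT).
  have aa : a * a^* = 1.
    have xx : '[T x, T x] != 0 by rewrite (ray_dot hT) dot_eq0.
    apply: (mulIf xx); rewrite mul1r; transitivity '[U x, U x].
      by rewrite Ux !dotE mulrA.
    rewrite Udot (ray_dot hT); have [r _ ->] := dot_real x0.
    exact: (sigma_rc hs).
  apply: bsa_ext => v w; rewrite Ux !(bsaE, dotE).
  by transitivity ((a * a^*) * ('[v, T x] * '[T x, w]));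
    [ring|rewrite aa mul1r].
have [B hB] := bsa_conj hs Ulin Udot UK VK A.
suff [r hr] : is_scalar (phi A - c *: B).
  exists r => x; have := congr1 (fun D : S => D (U x)) hr.
  by rewrite !bsaE hB => /eqP; rewrite subr_eq addrC => /eqP.
apply: scalar_eig => y; rewrite -(VK y); set x := V y.
have [->|x0] := eqVneq x 0.
  by rewrite (isometry0 Udot); exists 0; rewrite op0 scaler0.
have [w hw] := eig_rank_two A x0.
pose F := P (x + w) - P w; pose F' := P (U (x + w)) - P (U w).
(* Modulo scalars [phi F] is [c F'], and [F'] is the conjugate of [F] by [U]; so [U x] is an
   eigenvector of each of the three terms into which [phi A - c B] is split below. *)
have h1 : eig (phi A - phi F) (U x).
  have [a ->] := UT x; apply: eigZ; apply/comm_proj/commC.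
  have /comm_proj/(phi_comm_sub hsurj hphi _ _ _).1 := hw.
  by move/((hT x).2 _)=> h; apply/commC/comm_proj.
have h2 : is_scalar (phi F - c *: F').
  apply: (is_scalar_ext (hc (x + w) w 1 (-1))) => v v'.
  rewrite -!PU scaleN1r scale1r -/F !(bsaE, dotE) !rcE; ring.
have h3 : eig (B - F') (U x).
  have [k hk] := hw; exists (sigma k).
  rewrite -(isometryZ Ulin Udot) -hk /F' !(bsaNE, bsaDE) hB.
  rewrite !(proj_isometry Ulin Udot).
  by rewrite !(isometryD Ulin, isometryN Ulin Udot).
have [a1 e1] := h1; have [r2 e2] := h2; have [a3 e3] := h3.
exists (a1 + rc r2 - rc c * a3).
have -> : phi A - c *: B = (phi A - phi F) + (phi F - c *: F') - c *: (B - F').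
  by apply: bsa_ext => v v'; rewrite !(bsaE, dotE); ring.
rewrite e2 bsaDE bsaNE bsaDE !bsaZE e1 e3 bsa_oneE.
by rewrite cscalerBl cscalerDl cscalerA.
Qed.

End Representation.

(** * Standard forms and the vanishing of f *)

Section MainStep.
Variables (R : realType) (H : hilbertType R).
Local Notation S := (bounded_self_adjoint H).
Local Notation "''[' x , y ]" := (dot x y) : ring_scope.

Lemma quasi_commuteP (A B : S) : quasi_commute A B <-> quasicomm A B.
Proof.
split=> -[h|h].
- by left=> x; exact: (congr1 (@^~ x) h).
- by right=> x; exact: (congr1 (@^~ x) h).
- by left; apply/funext => x; exact: h.
- by right; apply/funext => x; exact: h.
Qed.

Lemma quasi_commute_subP (A B C : S) :
  quasi_commute (A \- B) C <-> quasicomm (A - B) C.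
Proof. by rewrite bsa_subE quasi_commuteP. Qed.

(** Collects what the unitary and antiunitary cases share; homogeneity over the reals suffices
    because [c] and [f A] are real. *)
Lemma standard_form_semilinear (phi : S -> S) (c : R) f (U Ustar : H -> H) :
  standard_form phi c f U Ustar ->
  [/\ forall x y, U (x + y) = U x + U y,
      forall (r : R) x, U (rc r *: x) = rc r *: U x,
      injective U &
      forall (A : S) x, phi A (U x) = rc c *: U (A x) + rc (f A) *: U x].
Proof.
case=> c0 hU hphi.
have UK : cancel U Ustar.
  move=> y; apply: dot_inj => x.
  case: hU => -[[_ bU dU] aU].
    by rewrite dotC (dotC y); congr (_^*); rewrite /dot -aU dU.
  rewrite dotC (dotC y); congr (_^*).
  by apply: (can_inj (@conjCK (Cx R))); rewrite /dot -aU dU.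
split.
- move=> x y; rewrite -[x]cscale1r; case: hU => -[[lU _ _] _].
    by rewrite (lU 1 x y) !cscale1r.
  by rewrite (lU 1 x y) conjC1 !cscale1r.
- move=> r x; have U0 : U 0 = 0.
    case: hU => -[[_ _ dU] _]; apply/eqP; rewrite -dot_eq0 /dot dU.
      by rewrite -/(dot _ _) dot0l.
    by rewrite -/(dot (0 : H) 0) dot0l conjC0.
  rewrite -[_ *: x]addr0; case: hU => -[[lU _ _] _].
    by rewrite (lU (rc r) x 0) U0 addr0.
  by rewrite (lU (rc r) x 0) U0 addr0 conj_rc.
- by case: hU => -[[_ /bij_inj ? _] _].
- by move=> A x; rewrite hphi UK.
Qed.

End MainStep.

Theorem theorem1p5 (R : realType) (H : hilbertType R)
  (phi : bounded_self_adjoint H -> bounded_self_adjoint H)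
  (hdim : dim_ge H 3)
  (hsurj : forall Y : bounded_self_adjoint H,
     exists X : bounded_self_adjoint H, phi X = Y)
  (hphi : forall A B C : bounded_self_adjoint H,
     quasi_commute (A \- B) C <-> quasi_commute (phi A \- phi B) (phi C)) :
  (exists (c : R) (f : bounded_self_adjoint H -> R) (U Ustar : H -> H),
     standard_form phi c f U Ustar) /\
  (forall (c : R) (f : bounded_self_adjoint H -> R) (U Ustar : H -> H),
     standard_form phi c f U Ustar ->
     forall A : bounded_self_adjoint H,
       (exists B : bounded_self_adjoint H,
          [/\ (B : H -> H) <> \0, ~ commute_op A B & (A \o B) \+ (B \o A) = \0]) ->
       f A = 0).
Proof.
have hq A B C : quasicomm (A - B) C <-> quasicomm (phi A - phi B) (phi C).
  by rewrite -!quasi_commute_subP; exact: hphi.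
split.
  have [c [U [V [sigma [c0 hs [Ulin Udot] [UK VK]]]]]] := phi_form hdim hsurj hq.
  move=> /choice[f hf]; exists c, f, U, V; split=> // [|A x]; last first.
    by rewrite -{1}(VK x) hf VK.
  have bU : bijective U by exists V.
  case: hs => hs; [left|right]; split.
  - split=> // [a x y|x y]; first by rewrite (Ulin a x y) hs.
    by have := Udot x y; rewrite hs.
  - by move=> x y; have := Udot x (V y); rewrite VK hs.
  - split=> // [a x y|x y]; first by rewrite (Ulin a x y) hs.
    by have := Udot x y; rewrite hs.
  - by move=> x y; have := Udot x (V y); rewrite VK hs.
move=> c f U Ustar hform A [B [_ ncomm anti]].
have [UD UZ Uinj phiE] := standard_form_semilinear hform.
have c0 : c != 0 by case: hform.
have anti' : anticomm B A.
  move=> x; apply/eqP; rewrite -addr_eq0 addrC; apply/eqP.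
  exact: (congr1 (@^~ x) anti).
have ncomm' : ~ comm B A.
  by move=> h; apply: ncomm; apply/funext => x /=; rewrite h.
have U0 : U 0 = 0 by apply: (addrI (U 0)); rewrite -UD !addr0.
have UN x : U (- x) = - U x.
  by apply: (addIr (U x)); rewrite -UD !addNr.
(* Subtracting [phi 0] puts the anticommutation of [B = B - 0] with [A] in the form that [hq]
   accepts. *)
have [|anti2] : quasicomm (phi B - phi 0) (phi A).
- by apply: (hq _ _ _).1; right; rewrite subr0.
- by move=> /(phi_comm_sub hsurj hq _ _ _).2; rewrite subr0.
apply: contrapT => /eqP fA0; apply: ncomm'.
pose b := f B - f 0.
(* Expand the anticommutation of [c B + b] with [c A + f A] after removing [U]: the [c^2] terms
   cancel, and half of the rest remains. If [f A] is nonzero, [B] is a combination of [A] and [I]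
   and commutes with [A]. *)
have key x : rc (f A * c) *: B x + rc (b * c) *: A x + rc (f A * b) *: x = 0.
  apply: Uinj; rewrite !UD !UZ U0; apply: dot_inj => z.
  have := congr1 (fun u => dot u z) (anti2 (U x)).
  rewrite !(bsaE, phiE, opE, anti', UN, U0, dotE) !rcE => h.
  have n2 : (2 : Cx R) != 0 by rewrite pnatr_eq0.
  apply: (mulfI n2); rewrite mulr0; apply/eqP.
  move/eqP: h; rewrite -subr_eq0; congr (_ == _); ring.
have BE : B = (- (b / f A)) *: A + (- (b / c)) *: bsa_one H.
  apply: bsaP => x; apply: dot_inj => z.
  have := congr1 (fun u => dot u z) (key x).
  rewrite !(bsaE, dotE) !rcE => h.
  have rc0' : rc c != 0 by rewrite rc_eq0.
  have rf0 : rc (f A) != 0 by rewrite rc_eq0.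
  apply: (mulfI (mulf_neq0 rf0 rc0')); apply/eqP; rewrite -subr_eq0.
  move/eqP: h; congr (_ == _); field; by rewrite !fmorph_eq0 c0.
by rewrite BE => x; rewrite !(bsaE, opE).
Qed.
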